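(* Let $\delta>0$. Suppose $(\mu_x\mid x\in[0,\delta])$ is a 1-parameter family of r-measures on $\overline{\mathbf{R}}^2$ (not necessarily finite). Suppose that for all $x,y\in[0,\delta]$ the box inequality $$\mu_x(R)\le\mu_y(R^{|y-x|})$$ holds for all rectangles $R\in\mathrm{Rect}(\overline{\mathbf{R}}^2)$. Write $F_x=F^\circ(\mu_x)$ for the finite interior of $\mu_x$. Then there exists a $\delta$-matching between the undecorated diagrams $(\mathrm{dgm}(\mu_0),F_0)$ and $(\mathrm{dgm}(\mu_\delta),F_\delta)$.
   Context: $\overline{\mathbf{R}}=[-\infty,+\infty]$. $\mathrm{Rect}(\overline{\mathbf{R}}^2)$ is the set of rectangles $[a,b]\times[c,d]$ with $-\infty\le a<b\le+\infty$ and $-\infty\le c<d\le+\infty$. An r-measure on $\overline{\mathbf{R}}^2$ is a function $\mu:\mathrm{Rect}(\overline{\mathbf{R}}^2)\to\{0,1,2,\dots\}\cup\{\infty\}$ such that, whenever $a<p<b$ and $c<q<d$, $\mu([a,b]\times[c,d])=\mu([a,p]\times[c,d])+\mu([p,b]\times[c,d])$ and $\mu([a,b]\times[c,d])=\mu([a,b]\times[c,q])+\mu([a,b]\times[q,d])$. The $\eta$-thickening of $R=[a,b]\times[c,d]$ is $R^\eta=[a-\eta,b+\eta]\times[c-\eta,d+\eta]$, with $\pm\infty$ unchanged by adding or subtracting $\eta$. Decorated numbers are symbols $p^+,p^-$ ($p\in\mathbf{R}$) together with $-\infty^+$ and $+\infty^-$; they are ordered, jointly with the extended reals, by $p^-<p<p^+$,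 and $p^+<q^-$ whenever $p<q$, with $-\infty<-\infty^+$ and $+\infty^-<+\infty$ the extreme elements. A decorated point $(p^*,q^* )$ belongs to $[a,b]\times[c,d]$ if $a<p^*<b$ and $c<q^*<d$. The finite r-interior $F^\bullet(\mu)$ is the set of decorated points belonging to some rectangle $R$ with $\mu(R)<\infty$. The finite interior $F^\circ(\mu)$ is the (open) set of points $(p,q)\in\overline{\mathbf{R}}^2$ lying in the interior, relative to $\overline{\mathbf{R}}^2$, of some rectangle $R$ with $\mu(R)<\infty$. There is a unique locally finite multiset $\mathrm{Dgm}(\mu)$ in $F^\bullet(\mu)$ such that, for every rectangle $R$ all of whose decorated points lie in $F^\bullet(\mu)$, the number of points of $\mathrm{Dgm}(\mu)$ (with multiplicity) belonging to $R$ is $\mu(R)$. The undecorated diagram is the pair $(\mathrm{dgm}(\mu),F^\circ(\mu))$, where $\mathrm{dgm}(\mu)$ is the multiset in $F^\circ(\mu)$ obtained from $\mathrm{Dgm}(\mu)$ by forgetting decorations and keeping only points in $F^\circ(\mu)$. $\mathrm{d}^\infty((p,q),(r,s))=\max(|p-r|,|q-s|)$ on $\overline{\mathbf{R}}^2$, where equal infinite coordinates contribute $0$ and the distance is $\infty$ if some coordinate is infinite in one point and not equal to the corresponding coordinate of the other. For an open set $F\subset\overline{\mathbf{R}}^2$ and $\alpha\in F$, $\mathrm{ex}^\infty(\alpha,F)=\min\{\mathrm{d}^\infty(\alpha,x)\mid x\in\overline{\mathbf{R}}^2-F\}$ ($\infty$ if the complement is empty), and for $\delta\ge0$ the reverse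 offset is $F^{-\delta}=\{\alpha\in F\mid\mathrm{ex}^\infty(\alpha,F)>\delta\}$. Multisets are regarded as sets by labelling repeated copies of points. Let $F,G\subset\overline{\mathbf{R}}^2$ be open, let $A,B$ be multisets in $F,G$ respectively and let $\delta>0$. A $\delta$-matching between $(A,F)$ and $(B,G)$ is a subset $M\subset A\times B$ in which each element of $A$ and of $B$ occurs in at most one pair, such that: (i) $F\supseteq G^{-\delta}$ and $G\supseteq F^{-\delta}$; (ii) if $(\alpha,\beta)\in M$ then $\mathrm{d}^\infty(\alpha,\beta)\le\delta$; (iii) every $\alpha\in A$ lying in $G^{-\delta}$ is matched with some $\beta\in B$; (iv) every $\beta\in B$ lying in $F^{-\delta}$ is matched with some $\alpha\in A$. *)

(* Defs.v *)
From mathcomp Require Import all_boot all_order all_algebra.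
From mathcomp Require Import all_classical all_reals all_analysis.

Set Implicit Arguments.
Unset Strict Implicit.
Unset Printing Implicit Defensive.

Import Order.TTheory GRing.Theory Num.Theory.
Import numFieldNormedType.Exports.

Local Open Scope classical_set_scope.
Local Open Scope ring_scope.
Local Open Scope ereal_scope.

Section Rectangles.
Context {R : realType}.

Record rect := Rect {
  xmin : \bar R; xmax : \bar R; ymin : \bar R; ymax : \bar R;
  xmin_lt_xmax : xmin < xmax;
  ymin_lt_ymax : ymin < ymax }.

Definition rect_set (r : rect) : set (\bar R * \bar R) :=
  `[xmin r, xmax r] `*` `[ymin r, ymax r].

Lemma thicken_lt (eta : {nonneg R}) (a b : \bar R) :
  a < b -> a - (eta%:num)%:E < b + (eta%:num)%:E.
Proof.
have eta0 : (0 <= eta%:num)%R by [].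
case: a b => [a| |] [b| |] //=; rewrite ?ltry ?ltNyr //.
rewrite -EFinB -EFinD !lte_fin => ab.
by apply: (le_lt_trans (y := a)); rewrite ?gerBl // ltr_wpDr.
Qed.

Definition thicken (eta : {nonneg R}) (r : rect) : rect :=
  Rect (thicken_lt eta (xmin_lt_xmax r)) (thicken_lt eta (ymin_lt_ymax r)).

(* Values in {0, 1, 2, ...} U {oo} are embedded in the extended reals. *)
Record is_rmeasure (mu : rect -> \bar R) : Prop := IsRMeasure {
  rmeasure_nat : forall r, mu r = +oo \/ exists n : nat, mu r = n%:R%:E;
  rmeasure_splitx : forall (a p b c d : \bar R)
      (ap : a < p) (pb : p < b) (cd : c < d),
    mu (Rect (lt_trans ap pb) cd) = mu (Rect ap cd) + mu (Rect pb cd);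
  rmeasure_splity : forall (a b c q d : \bar R)
      (ab : a < b) (cq : c < q) (qd : q < d),
    mu (Rect ab (lt_trans cq qd)) = mu (Rect ab cq) + mu (Rect ab qd) }.

(* The pair (p, true) is p^+ and (p, false) is p^-; the only decorated
   infinities are -oo^+ and +oo^-. *)
Definition decorated : Type :=
  {x : \bar R * bool | (x != (-oo, false)) && (x != (+oo, true))}.

Definition undecorate (p : decorated) : \bar R := (val p).1.

(* The joint order on extended reals and decorated numbers is the lexicographic
   order on these keys, since p^- < p < p^+, and p^+ < q^- for p < q. *)
Definition ereal_key (a : \bar R) : \bar R *l int := (a, 0%R : int).
Definition decorated_key (p : decorated) : \bar R *l int :=
  (undecorate p, (if (val p).2 then 1 else -1)%R : int).

Definition dpoint : Type := (decorated * decorated)%type.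

Definition undecorate_point (z : dpoint) : \bar R * \bar R :=
  (undecorate z.1, undecorate z.2).

Definition dpoints (r : rect) : set dpoint :=
  [set z | [/\ (ereal_key (xmin r) < decorated_key z.1)%O,
               (decorated_key z.1 < ereal_key (xmax r))%O,
               (ereal_key (ymin r) < decorated_key z.2)%O &
               (decorated_key z.2 < ereal_key (ymax r))%O]].

Definition finite_rinterior (mu : rect -> \bar R) : set dpoint :=
  [set z | exists2 r, mu r < +oo & dpoints r z].

Definition finite_interior (mu : rect -> \bar R) : set (\bar R * \bar R) :=
  [set z | exists2 r, mu r < +oo & (rect_set r)° z].

(* Multisets are given by their multiplicity functions. *)
Definition card_in (D : dpoint -> nat) (r : rect) : \bar R :=
  \esum_(z in dpoints r) (D z)%:R%:E.

Record is_Dgm (mu : rect -> \bar R) (D : dpoint -> nat) : Prop := IsDgm {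
  Dgm_support : forall z, (0 < D z)%N -> finite_rinterior mu z;
  Dgm_locally_finite : forall r,
    dpoints r `<=` finite_rinterior mu -> card_in D r < +oo;
  Dgm_card : forall r,
    dpoints r `<=` finite_rinterior mu -> card_in D r = mu r }.

(* For an r-measure there is exactly one D such that is_Dgm mu D; the default
   value of xget is irrelevant. *)
Definition Dgm (mu : rect -> \bar R) : dpoint -> nat :=
  xget (fun=> 0%N) [set D | is_Dgm mu D].

(* The sum ranges over the at most four decorations of z. *)
Definition dgm (mu : rect -> \bar R) (z : \bar R * \bar R) : nat :=
  if z \in finite_interior mu
  then \big[addn/0%N]_(w \in [set w | undecorate_point w = z]) Dgm mu w
  else 0%N.

End Rectangles.
Arguments rect : clear implicits.
Arguments decorated : clear implicits.
Arguments dpoint : clear implicits.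

Section Matchings.
Context {R : realType}.
Local Notation point := (\bar R * \bar R)%type.

(* The case split makes equal infinite coordinates contribute 0; in the library
   +oo - +oo = -oo. *)
Definition coord_dist (p q : \bar R) : \bar R :=
  if p == q then 0 else `|p - q|.

Definition dinfty (z w : point) : \bar R :=
  Order.max (coord_dist z.1 w.1) (coord_dist z.2 w.2).

(* The infimum is a minimum when F is open and not the whole plane. *)
Definition exinfty (z : point) (F : set point) : \bar R :=
  ereal_inf [set dinfty z w | w in ~` F].

Definition reverse_offset (F : set point) (delta : R) : set point :=
  [set z | F z /\ delta%:E < exinfty z F].

Definition labelled (A : point -> nat) : set (point * nat) :=
  [set a | (a.2 < A a.1)%N].

Record is_matching (delta : R) (A : point -> nat) (F : set point)
    (B : point -> nat) (G : set point)
    (M : set ((point * nat) * (point * nat))) : Prop := IsMatching {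
  matching_sub : M `<=` labelled A `*` labelled B;
  matching_injl : forall a b b', M (a, b) -> M (a, b') -> b = b';
  matching_injr : forall a a' b, M (a, b) -> M (a', b) -> a = a';
  matching_offsetl : reverse_offset G delta `<=` F;
  matching_offsetr : reverse_offset F delta `<=` G;
  matching_dist : forall a b, M (a, b) -> dinfty a.1 b.1 <= delta%:E;
  matching_totall : forall a, labelled A a -> reverse_offset G delta a.1 ->
    exists b, M (a, b);
  matching_totalr : forall b, labelled B b -> reverse_offset F delta b.1 ->
    exists a, M (a, b) }.

End Matchings.

(* Main.v *)
(** For finitely many points [z] of the diagram at time [0] whose closed
    [delta]-balls lie in the finite interior at time [delta], let [f x] be the
    number of diagram points at time [x] in the union of the closed [x]-balls
    around them.  The box inequality, applied to small balls around the finitely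
    many points counted by [f x], shows that [f] is locally nondecreasing on both
    sides of [x], hence [f 0 <= f delta].  This is Hall's condition for the
    bipartite graph joining points at distance at most [delta]; all degrees are
    finite, so the infinite marriage theorem matches every point that has to be
    matched on one side.  Reversing time gives the other side, and the two partial
    matchings are merged as in the proof of the Cantor-Bernstein theorem. *)
Require Import Defs.
From mathcomp Require Import all_boot all_order all_algebra finmap.
From mathcomp Require Import all_classical all_reals all_analysis.
From mathcomp Require Import zify lra.

Set Implicit Arguments.
Unset Strict Implicit.
Unset Printing Implicit Defensive.

Import Order.TTheory GRing.Theory Num.Theory.
Import numFieldNormedType.Exports.

Local Open Scope classical_set_scope.
Local Open Scope ring_scope.
Local Open Scope ereal_scope.

(** * Marriage theorems *)

(** Diagrams may be infinite, and points may emerge from or vanish into the region of infinite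
    measure, so counting is confined to closed balls known to lie in the finite interior. Letting
    the radius equal the time serves two purposes: a point moving at unit speed cannot leave the
    ball, and thickening the [x]-ball by [delta - x] gives the [delta]-ball, whose finiteness at
    time [delta] thus passes back to time [x]. A further obstacle is that the measures count
    decorated points in rectangles, whereas matchings concern undecorated points in closed balls. A
    closed box in the finite interior has a surrounding rectangle so tight that it carries no
    further points of the diagram; this turns the box inequality into one between closed boxes.
    Moreover [Dgm] is chosen by [xget], so its properties are available only once a diagram has been
    constructed, here from the least measure of the rectangles around each decorated point. *)

Section Hall.
Context {I T : choiceType}.
Local Open Scope fset_scope.
Implicit Types J : {fset I}.

Definition hall (S : I -> {fset T}) :=
  forall J, (#|` J| <= #|` \bigcup_(j <- J) S j|)%N.

Definition is_subhall (S0 S : I -> {fset T}) :=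
  hall S /\ forall i, S i `<=` S0 i.

Definition subhall S0 := sig (is_subhall S0).

Definition shrinks S0 : rel (subhall S0) :=
  fun S S' => `[< forall i, sval S' i `<=` sval S i >].

(** At each index the chain has a member of least cardinality, which by totality lies in all the
    others. Taking these least sets gives the bound; Hall's condition survives because a finite [J]
    sees only finitely many indices. *)
Lemma subhall_chain_bound S0 (C : set (subhall S0)) : hall S0 ->
  total_on C (@shrinks S0) -> exists S, forall S', C S' -> shrinks S' S.
Proof.
move=> hS0 totC; have [[S1 CS1]|C0] := pselect (exists S, C S); last first.
  have S00 : is_subhall S0 S0 by split.
  by exists (exist _ _ S00) => S' CS'; case: C0; exists S'.
have minC i : exists S, C S /\
    forall S', C S' -> (#|` sval S i| <= #|` sval S' i|)%N.
  have ex : exists n, `[< exists S, C S /\ #|` sval S i| = n >].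
    by exists #|` sval S1 i|; apply/asboolP; exists S1.
  case: (ex_minnP ex) => _ /asboolP[S [CS <-]] minS.
  by exists S; split=> // S' CS'; apply: minS; apply/asboolP; exists S'.
have [g gP] := choice minC.
have leg i S' : C S' -> sval (g i) i `<=` sval S' i.
  move=> CS'; have [Cg mg] := gP i.
  have [/asboolP/(_ i)|/asboolP/(_ i)//] := totC _ _ Cg CS'.
  move=> S'g; suff -> : sval S' i = sval (g i) i by [].
  by apply/eqP; rewrite eqEfcard S'g mg.
(* A single member of the chain attains the least set at all the indices of a finite list. *)
have common (s : seq I) : exists S, C S /\ {in s, forall i, sval S i = sval (g i) i}.
  elim: s => [|i s [S [CS IH]]]; first by exists S1.
  have [Cg _] := gP i.
  have [/asboolP gS|/asboolP Sg] := totC _ _ Cg CS.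
    exists S; split=> // j; rewrite inE => /predU1P[->|/IH//].
    by apply/eqP; rewrite eqEfsubset gS leg.
  exists (g i); split=> // j; rewrite inE => /predU1P[->//|js].
  by apply/eqP; rewrite eqEfsubset -{1}(IH _ js) Sg leg.
suff hg : is_subhall S0 (fun i => sval (g i) i).
  by exists (exist _ _ hg) => S' CS'; apply/asboolP => i; exact: leg.
split=> [J|i]; last exact: (svalP (g i)).2.
have [S [CS SJ]] := common J.
apply: leq_trans ((svalP S).1 J) _; apply: eq_leq; congr #|` _|.
by apply: eq_big_seq.
Qed.

(* Rado's argument: if [x] and [y] both belonged to [S i], with neither of them
   removable, the two violating finite sets would contradict the modularity of
   cardinality. *)
Lemma hall_minimal_unique (S : I -> {fset T}) i x y : hall S ->
  (forall S', hall S' -> (forall j, S' j `<=` S j) -> S' = S) ->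
  x \in S i -> y \in S i -> x = y.
Proof.
move=> hS minS xi yi; apply/eqP/negPn/negP => xy.
pose U (J : {fset I}) := \bigcup_(j <- J) S j.
have viol z : z \in S i -> exists J : {fset I}, i \notin J /\
    (#|` (S i `\ z) `|` U J| <= #|` J|)%N.
  move=> zi; pose Sz j := if j == i then S i `\ z else S j.
  have /existsNP[J] : ~ hall Sz.
    move=> hSz; have : z \in Sz i.
      rewrite (minS _ hSz) // => j; rewrite /Sz; case: eqP => [->|_] //.
      exact: fsubD1set.
    by rewrite /Sz eqxx !inE eqxx.
  move/negP; rewrite -ltnNge => SzJ.
  have iJ : i \in J.
    apply: contraLR SzJ => iJ; rewrite -leqNgt (leq_trans (hS J)) //.
    apply: eq_leq; congr #|` _|; apply: eq_big_seq => j jJ.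
    by rewrite /Sz; case: eqP => // ji; rewrite -ji jJ in iJ.
  exists (J `\ i); split; first by rewrite !inE eqxx.
  have : #|` J| = (1 + #|` J `\ i|)%N by rewrite (cardfsD1 i J) iJ.
  move=> JE; rewrite JE ltnS in SzJ; apply: leq_trans SzJ.
  apply: fsubset_leq_card; apply/fsubsetP => t; rewrite in_fsetU.
  move=> /orP[tz|/bigfcupP[j /andP[jJ _] tj]]; apply/bigfcupP.
    by exists i; rewrite ?iJ // /Sz eqxx.
  by move: jJ; rewrite !inE => /andP[/negPf ji jJ]; exists j; rewrite ?jJ // /Sz ji.
have [J1 [iJ1 c1]] := viol x xi; have [J2 [iJ2 c2]] := viol y yi.
set X := _ `|` _ in c1; set Y := _ `|` _ in c2.
(* As [x] and [y] differ, the two punctured copies of [S i] together contain [S i], so the union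
   also serves the index [i]: this is the extra one that breaks the final count. *)
have cU : (#|` J1 `|` J2|.+1 <= #|` X `|` Y|)%N.
  have -> : #|` J1 `|` J2|.+1 = #|` i |` (J1 `|` J2)|.
    by rewrite cardfsU1 !inE negb_or iJ1 iJ2.
  apply: leq_trans (hS _) _; apply: fsubset_leq_card; apply/fsubsetP => t.
  move=> /bigfcupP[j /andP[+ _] tj]; rewrite !inE.
  move=> /orP[/eqP ji|/orP[jJ|jJ]].
  - by rewrite -ji tj !andbT; case: eqP => //= ->; rewrite xy orbT.
  - by apply/orP; left; apply/orP; right; apply/bigfcupP; exists j; rewrite ?jJ.
  - by apply/orP; right; apply/orP; right; apply/bigfcupP; exists j; rewrite ?jJ.
have cI : (#|` J1 `&` J2| <= #|` X `&` Y|)%N.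
  apply: leq_trans (hS _) _; apply: fsubset_leq_card; apply/fsubsetP => t.
  move=> /bigfcupP[j /andP[+ _] tj]; rewrite !inE => /andP[j1 j2].
  by apply/andP; split; apply/orP; right; apply/bigfcupP; exists j; rewrite ?j1 ?j2.
have := cardfsUI X Y; have := cardfsUI J1 J2.
move: c1 c2 cU cI; clear; lia.
Qed.

(** In a minimal Hall family every set is a singleton. Hall's condition for one index gives the
    element, and for two indices it forbids a repeated choice. *)
Lemma hall_marriage S0 : hall S0 ->
  exists2 f : I -> T, injective f & forall i, f i \in S0 i.
Proof.
move=> hS0.
have [|||C /(subhall_chain_bound hS0)//|[S [hS SS0]] minS] :=
  @Zorn (subhall S0) (@shrinks S0).
- by move=> S; apply/asboolP.
- move=> S1 S2 S3 /asboolP S21 /asboolP S32; apply/asboolP => i.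
  exact: fsubset_trans (S32 i) (S21 i).
- move=> [S1 h1] [S2 h2] /asboolP/= S21 /asboolP/= S12.
  apply: eq_exist; apply/funext => i; apply/eqP.
  by rewrite eqEfsubset S12 S21.
have {}minS S' : hall S' -> (forall i, S' i `<=` S i) -> S' = S.
  move=> hS' S'S.
  have S'0 : is_subhall S0 S'.
    by split=> // i; apply: fsubset_trans (S'S i) (SS0 i).
  have /(congr1 sval)// : exist _ S' S'0 = exist _ S (conj hS SS0).
  by apply: minS; apply/asboolP.
have S_neq0 i : exists x, x \in S i.
  have := hS [fset i]; rewrite cardfs1 big_seq_fset1 cardfs_gt0.
  by move/fset0Pn.
have [f fS] := choice S_neq0.
exists f => [i j fij|i]; last exact: (fsubsetP (SS0 i)).
apply/eqP/negPn/negP => ij.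
have := hS [fset i; j]; rewrite cardfs2 ij => /leq_trans.
have UE : \bigcup_(k <- [fset i; j]) S k `<=` [fset f i].
  apply/fsubsetP => t /bigfcupP[k /andP[+ _] tk].
  rewrite !inE => /orP[] /eqP kE; rewrite kE in tk; apply/eqP.
    exact: hall_minimal_unique hS minS tk (fS i).
  by rewrite fij; apply: hall_minimal_unique hS minS tk (fS j).
by move=> /(_ _ (fsubset_leq_card UE)); rewrite cardfs1.
Qed.
End Hall.

(** * Merging two partial matchings *)

Section Combine.
Context {A B : Type} (A0 : set A) (B0 : set B) (M1 M2 : set (A * B)).

(* The elements of [A0] whose alternating path, read backwards, stops at an
   element of [A0] that [M2] does not match into [B0]: these keep their
   [M1]-partner, as in the proof of the Cantor-Bernstein theorem. *)
Inductive chain : A -> Prop :=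
| chain0 a : A0 a -> (forall b, B0 b -> ~ M2 (a, b)) -> chain a
| chainS a a' b : chain a -> M1 (a, b) -> B0 b -> M2 (a', b) -> A0 a' ->
    chain a'.

Lemma combine_matchings :
  (forall a b b', M1 (a, b) -> M1 (a, b') -> b = b') ->
  (forall a a' b, M1 (a, b) -> M1 (a', b) -> a = a') ->
  (forall a b b', M2 (a, b) -> M2 (a, b') -> b = b') ->
  (forall a a' b, M2 (a, b) -> M2 (a', b) -> a = a') ->
  (forall a, A0 a -> exists b, M1 (a, b)) ->
  (forall b, B0 b -> exists a, M2 (a, b)) ->
  exists M : set (A * B),
    [/\ M `<=` M1 `|` M2,
        forall a b b', M (a, b) -> M (a, b') -> b = b',
        forall a a' b, M (a, b) -> M (a', b) -> a = a',
        forall a, A0 a -> exists b, M (a, b) &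
        forall b, B0 b -> exists a, M (a, b)].
Proof.
move=> M1l M1r M2l M2r M1tot M2tot.
pose reached b := exists2 a, chain a & M1 (a, b).
pose M : set (A * B) := [set ab | chain ab.1 /\ M1 ab \/
  [/\ B0 ab.2, M2 ab & ~ reached ab.2]].
(* A chain element with an [M2]-partner in [B0] is not a starting point, so the step that produced
   it passed through that partner, the only one it has. *)
have mixed a b' : chain a -> B0 b' -> M2 (a, b') -> reached b'.
  move=> ca; case: a / ca => [a _ nob Bb' Mab'|c a b'' cc Mc Bb'' Mab'' _ _ Mab'].
    by case: (nob b').
  by exists c; rewrite // (M2l _ _ _ Mab' Mab'').
exists M; split.
- by move=> [a b] [[_ ?]|[_ ? _]]; [left|right].
- move=> a b b' /= [[ca Mab]|[Bb Mab nb]] [[ca' Mab']|[Bb' Mab' nb']] /=.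
  + exact: M1l Mab Mab'.
  + by case: nb'; apply: mixed Mab'.
  + by case: nb; apply: mixed Mab.
  + exact: M2l Mab Mab'.
- move=> a a' b /= [[ca Mab]|[Bb Mab nb]] [[ca' Mab']|[Bb' Mab' nb']] /=.
  + exact: M1r Mab Mab'.
  + by case: nb'; exists a.
  + by case: nb; exists a'.
  + exact: M2r Mab Mab'.
- move=> a Aa; have [ca|nca] := pselect (chain a).
    by have [b Mab] := M1tot a Aa; exists b; left.
  have [[b [Bb Mab]]|nb] := pselect (exists b, B0 b /\ M2 (a, b)).
    exists b; right; split=> // -[c cc Mcb]; apply: nca.
    exact: chainS cc Mcb Bb Mab Aa.
  by case: nca; apply: chain0 => // b Bb Mab; apply: nb; exists b.
- move=> b Bb; have [[a ca Mab]|nb] := pselect (reached b).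
    by exists a; left.
  by have [a Mab] := M2tot b Bb; exists a; right.
Qed.
End Combine.

(** * Induction along intervals of the extended line *)

Section ErealIntervals.
Context {R : realType}.
Implicit Types a b p s t x y : \bar R.

Lemma ereal_between x y : x < y -> exists2 z, x < z & z < y.
Proof.
case: x y => [x| |] [y| |] //; rewrite ?lte_fin ?ltry ?ltNyr //.
- move=> xy; exists ((x + y) / 2)%:E; rewrite lte_fin; lra.
- by move=> _; exists (x + 1)%:E; rewrite ?ltry // lte_fin; lra.
- by move=> _; exists (y - 1)%:E; rewrite ?ltNyr // lte_fin; lra.
- by move=> _; exists 0.
Qed.

Lemma ereal_sup_between (S : set \bar R) x a b : S x ->
  (forall y, S y -> a <= y <= b) -> a <= ereal_sup S <= b.
Proof.
move=> Sx Sab; have /andP[ax _] := Sab _ Sx; apply/andP; split.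
  by rewrite (le_trans ax)// ereal_sup_ubound.
by apply: ge_ereal_sup => y /Sab/andP[].
Qed.

(** The supremum of the endpoints reachable from [a] is reached by the left condition and, were it
    below [b], would be passed by the right one. This replaces compactness for decorated boxes, for
    closed boxes and for the time interval. *)
Lemma interval_induction (Q : \bar R -> \bar R -> Prop) a b :
  (forall s p t, a <= s -> s < p -> p < t -> t <= b ->
    Q s p -> Q p t -> Q s t) ->
  (forall p, a <= p -> p < b ->
    exists2 t, p < t & forall t', p < t' -> t' <= t -> t' <= b -> Q p t') ->
  (forall p, a < p -> p <= b ->
    exists2 s, s < p & forall s', s <= s' -> s' < p -> a <= s' -> Q s' p) ->
  a < b -> Q a b.
Proof.
move=> Qadd Qr Ql ab.
(* The guard [a < t] puts [a] itself into [S] without asking for [Q a a]. *)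
pose S := [set t | a <= t <= b /\ (a < t -> Q a t)].
have Sa : S a by rewrite /S/= lexx ltW // ltxx.
have Sab y : S y -> a <= y <= b by case.
set m := ereal_sup S; have /andP[am mb] : a <= m <= b.
  exact: ereal_sup_between Sa Sab.
have Sm : S m.
  split=> [|am']; first by rewrite am.
  have [s sm Qs] := Ql _ am' mb.
  have [t St st] : exists2 t, S t & Order.max a s < t.
    by apply: ereal_sup_gt; rewrite gt_max am' sm.
  have tm : t <= m by apply: ereal_sup_ubound.
  move: st; rewrite gt_max => /andP[at_ st].
  have [/andP[_ tb] /(_ at_) Qt] := St.
  move: tm; rewrite le_eqVlt => /predU1P[<-//|tm].
  apply: (Qadd a t m) => //; apply: Qs => //; exact: ltW.
move: mb; rewrite le_eqVlt => /predU1P[mb|mb].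
  by case: Sm => _; rewrite mb; apply.
have [t mt Qt] := Qr _ am mb.
pose t' := Order.min t b.
have mt' : m < t' by rewrite lt_min mt mb.
have Qmt' : Q m t' by apply: Qt => //; rewrite /t' ge_min lexx ?orbT.
suff : t' <= m by rewrite leNgt mt'.
apply: ereal_sup_ubound; split.
  by rewrite (le_trans am (ltW mt'))/= ge_min lexx orbT.
move=> at'; move: am; rewrite le_eqVlt => /predU1P[->//|am].
apply: (Qadd a m t') => //; first by rewrite /t' ge_min lexx orbT.
by case: Sm => _; apply.
Qed.
End ErealIntervals.

(** * Decorated numbers *)

Section Decorated.
Context {R : realType}.
Implicit Types (a b c d p q : \bar R) (u v w : decorated R).

(* Decorated numbers are handled as cuts of the extended line: only the set of
   extended reals below them matters. *)
Definition below a w : bool := (ereal_key a < decorated_key w)%O.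

Lemma belowE a w : below a w = (a < undecorate w) || (a == undecorate w) && (val w).2.
Proof.
rewrite /below /ereal_key /decorated_key ltEprodlexi /=.
case: w => [[x s] wP]; rewrite /undecorate /=.
by have [h|h|h] := ltgtP a x; rewrite /= ?implyTb; case: s wP => /=.
Qed.

Lemma nbelowE a w : ~~ below a w = (decorated_key w < ereal_key a)%O.
Proof.
rewrite belowE /ereal_key /decorated_key ltEprodlexi /=.
case: w => [[x s] wP]; rewrite /undecorate /=.
by have [h|h|h] := ltgtP a x; rewrite /= ?implyTb; case: s wP => /=.
Qed.

Lemma below_anti a b w : a <= b -> below b w -> below a w.
Proof.
rewrite !belowE; move=> ab /orP[bw|/andP[/eqP bw ->]].
  by rewrite (le_lt_trans ab bw).
by rewrite -bw andbT orbC -le_eqVlt.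
Qed.

Lemma below_lt a b w : below a w -> ~~ below b w -> a < b.
Proof. by move=> aw; rewrite ltNge; apply: contra => /below_anti; apply. Qed.

Lemma below_le a w : below a w -> a <= undecorate w.
Proof.
by rewrite belowE => /orP[/ltW//|/andP[/eqP-> _]].
Qed.

Lemma nbelow_le a w : ~~ below a w -> undecorate w <= a.
Proof. by rewrite belowE negb_or -leNgt => /andP[]. Qed.

Lemma below_maxE a b w : below (Order.max a b) w = below a w && below b w.
Proof.
have [ab|/ltW ba] := leP a b.
  by apply/idP/andP => [bw|[]//]; split=> //; exact: below_anti bw.
by apply/idP/andP => [aw|[]//]; split=> //; exact: below_anti aw.
Qed.

Lemma below_minE a b w : below (Order.min a b) w = below a w || below b w.
Proof.
have [ab|/ltW ba] := leP a b.
  by apply/idP/orP => [->|[//|]]; [left|exact: below_anti].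
by apply/idP/orP => [->|[|//]]; [right|exact: below_anti].
Qed.

Lemma decorated_plus p : p < +oo -> exists w, forall a, below a w = (a <= p).
Proof.
move=> poo; have pP : ((p, true) != (-oo, false)) && ((p, true) != (+oo, true)).
  by rewrite !xpair_eqE andbF /= andbT lt_eqF.
exists (exist _ (p, true) pP) => a.
by rewrite belowE /undecorate /= andbT orbC -le_eqVlt.
Qed.

Lemma decorated_minus p : -oo < p -> exists w, forall a, below a w = (a < p).
Proof.
move=> poo; have pP : ((p, false) != (-oo, false)) && ((p, false) != (+oo, true)).
  by rewrite !xpair_eqE andbF /= !andbT gt_eqF.
exists (exist _ (p, false) pP) => a.
by rewrite belowE /undecorate /= andbF orbF.
Qed.

(** If the underlying values differ, a number strictly between them separates; if they agree, the
    common value separates [p^-] from [p^+]. *)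
Lemma decorated_separated v w : v != w -> exists p, below p v != below p w.
Proof.
wlog vw : v w / undecorate v <= undecorate w.
  move=> sep; have /orP[] := le_total (undecorate v) (undecorate w); first exact: sep.
  by move=> wv; rewrite eq_sym => /(sep _ _ wv)[p]; rewrite eq_sym; exists p.
move=> vNw; move: vw; rewrite le_eqVlt => /predU1P[vw|/ereal_between[p vp pw]].
  exists (undecorate w); rewrite !belowE -vw ltxx eqxx /=.
  apply: contra vNw => /eqP vw2; apply/eqP/val_inj.
  have /= := vw; rewrite /undecorate => vw1.
  by rewrite [LHS]surjective_pairing [RHS]surjective_pairing vw1 vw2.
by exists p; rewrite !belowE pw ltNge (ltW vp) (gt_eqF vp).
Qed.

Definition dbox a b c d : set (dpoint R) :=
  [set z | [/\ below a z.1, ~~ below b z.1, below c z.2 & ~~ below d z.2]].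

Lemma dpointsE (r : rect R) : dpoints r = dbox (xmin r) (xmax r) (ymin r) (ymax r).
Proof. by apply/seteqP; split=> z; rewrite /dpoints /dbox /= !nbelowE. Qed.

Lemma dbox_sub a b c d a' b' c' d' : a <= a' -> b' <= b -> c <= c' -> d' <= d ->
  dbox a' b' c' d' `<=` dbox a b c d.
Proof.
move=> aa' b'b cc' d'd z [az bz cz dz]; split.
- exact: below_anti az.
- exact: contra (below_anti b'b) bz.
- exact: below_anti cz.
- exact: contra (below_anti d'd) dz.
Qed.

(* Compactness of rectangles of decorated points. *)
Lemma dbox_tube (P : \bar R -> \bar R -> \bar R -> \bar R -> Prop) a b c d :
  (forall a b c d a' b' c' d', a <= a' -> b' <= b -> c <= c' -> d' <= d ->
    P a b c d -> P a' b' c' d') ->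
  (forall a p b c d, a <= p -> p <= b ->
    P a p c d -> P p b c d -> P a b c d) ->
  (forall a b c q d, c <= q -> q <= d ->
    P a b c q -> P a b q d -> P a b c d) ->
  a < b -> c < d ->
  (forall z, dbox a b c d z -> exists a' b' c' d',
    dbox a' b' c' d' z /\ P a' b' c' d') ->
  P a b c d.
Proof.
move=> Psub Paddx Paddy ab cd loc.
(* The vertical segment over one cut [v] is treated first. Adjacent pieces are restricted to the
   intersection of their widths, so that they can be added vertically. *)
have slab v : below a v -> ~~ below b v ->
    exists a' b', [/\ below a' v, ~~ below b' v & P a' b' c d].
  move=> av bv.
  apply: (interval_induction
    (Q := fun s t => exists a' b', [/\ below a' v, ~~ below b' v & P a' b' s t])) cd.
  - move=> s p t cs sp pt td [a1 [b1 [av1 bv1 P1]]] [a2 [b2 [av2 bv2 P2]]].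
    exists (Order.max a1 a2), (Order.min b1 b2).
    rewrite below_maxE av1 av2 below_minE negb_or bv1 bv2; split=> //.
    apply: (Paddy _ _ _ p); [exact: ltW|exact: ltW| |].
      by apply: Psub P1; rewrite ?lexx// ?le_max ?ge_min ?lexx.
    by apply: Psub P2; rewrite ?lexx// ?le_max ?ge_min ?lexx ?orbT.
  (* A box containing [(v, p^+)] covers a strip just above [p], and one containing [(v, p^-)] a
     strip just below: decorations supply exactly the two one-sided hypotheses of the induction. *)
  - move=> p cp pd; have [w wE] := decorated_plus (lt_le_trans pd (leey d)).
    have [|a' [b' [c' [d' [[/= av' bv' cw dw] P']]]]] := loc (v, w).
      by rewrite /dbox /= !wE -ltNge.
    rewrite !wE -?ltNge in cw dw.
    exists d' => // t pt td' _; exists a', b'; split=> //.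
    by apply: Psub P'.
  - move=> p cp pd; have [w wE] := decorated_minus (le_lt_trans (leNye c) cp).
    have [|a' [b' [c' [d' [[/= av' bv' cw dw] P']]]]] := loc (v, w).
      by rewrite /dbox /= !wE -(leNgt p d).
    rewrite !wE -?leNgt in cw dw.
    exists c' => // s c's sp _; exists a', b'; split=> //.
    by apply: Psub P'.
apply: (interval_induction (Q := fun s t => P s t c d)) ab.
- by move=> s p t _ sp pt _; apply: Paddx; exact: ltW.
- move=> p ap pb; have [v vE] := decorated_plus (lt_le_trans pb (leey b)).
  have [||a' [b' [av bv P']]] := slab v; rewrite ?vE -?ltNge //.
  rewrite !vE -?ltNge in av bv.
  by exists b' => // t pt tb' _; apply: Psub P'.
- move=> p ap pb; have [v vE] := decorated_minus (le_lt_trans (leNye a) ap).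
  have [||a' [b' [av bv P']]] := slab v; rewrite ?vE -?leNgt //.
  rewrite !vE -?leNgt in av bv.
  by exists a' => // t pt tb' _; apply: Psub P'.
Qed.
End Decorated.

(** * Counting with multiplicities *)

Section Multiplicity.
Context {R : realType} {T : choiceType}.
Implicit Types (N : T -> nat) (A B : set T).

Definition msum N A : \bar R := \esum_(z in A) (N z)%:R%:E.

Lemma msum_term_ge0 N z : 0 <= (N z)%:R%:E :> \bar R.
Proof. by rewrite lee_fin ler0n. Qed.

Lemma msumE N A : msum N A = \esum_(z in [set: T]) (if z \in A then (N z)%:R%:E else 0).
Proof. exact: esum_mkcond. Qed.

Lemma msum_ge0 N A : 0 <= msum N A.
Proof. by apply: esum_ge0 => z _; exact: msum_term_ge0. Qed.

Lemma le_msum N A B : (forall z, A z -> (0 < N z)%N -> B z) -> msum N A <= msum N B.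
Proof.
move=> AB; rewrite !msumE; apply: le_esum => z _.
case: ifPn => [/set_mem Az|_]; last by case: ifP => // _; exact: msum_term_ge0.
case: (posnP (N z)) => [->|/(AB z Az)/mem_set ->//].
by case: ifP.
Qed.

Lemma msum_sub N A B : A `<=` B -> msum N A <= msum N B.
Proof. by move=> AB; apply: le_msum => z /AB. Qed.

Lemma eq_msum N A B : (forall z, (0 < N z)%N -> A z <-> B z) -> msum N A = msum N B.
Proof.
by move=> AB; apply: le_anti; rewrite !le_msum// => z ? /AB; tauto.
Qed.

Lemma msum1 N z : msum N [set z] = (N z)%:R%:E.
Proof. by rewrite /msum esum_set1 ?msum_term_ge0. Qed.

Lemma msumU N A B : A `&` B = set0 -> msum N (A `|` B) = msum N A + msum N B.
Proof.
move=> /seteqP[AB0 _]; rewrite !msumE -esumD; last 2 first.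
- by move=> z _; case: ifP => // _; exact: msum_term_ge0.
- by move=> z _; case: ifP => // _; exact: msum_term_ge0.
apply: eq_esum => z _; rewrite in_setU.
have [zA|zA] := boolP (z \in A); have [zB|zB] := boolP (z \in B) => //=.
- by exfalso; apply: (AB0 z); split; exact/set_mem.
- by rewrite adde0.
- by rewrite add0e.
- by rewrite adde0.
Qed.

Lemma msum_cover {S : eqType} N A (B : S -> set T) (s : seq S) :
  (forall z, A z -> (0 < N z)%N -> exists2 b, b \in s & B b z) ->
  msum N A <= \sum_(b <- s) msum N (B b).
Proof.
move=> cov.
have -> : \sum_(b <- s) msum N (B b) =
    \esum_(z in [set: T]) \sum_(b <- s) (if z \in B b then (N z)%:R%:E else 0).
  elim: s {cov} => [|b s IH].
    by rewrite big_nil esum1// => z _; rewrite big_nil.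
  rewrite big_cons IH msumE -esumD.
  - by apply: eq_esum => z _; rewrite big_cons.
  - by move=> z _; case: ifP => // _; exact: msum_term_ge0.
  - move=> z _; apply: sume_ge0 => c _; case: ifP => // _; exact: msum_term_ge0.
rewrite msumE; apply: le_esum => z _.
have pos (r : seq S) : 0 <= \sum_(b <- r) (if z \in B b then (N z)%:R%:E else 0 : \bar R).
  by apply: sume_ge0 => c _; case: ifP => // _; exact: msum_term_ge0.
case: ifPn => [/set_mem Az|_]; last exact: pos.
case: (posnP (N z)) => [-> //|/(cov z Az)[b bs Bb]].
  by apply: sume_ge0 => c _; case: ifP.
by rewrite (big_rem b bs) /= mem_set// leeDl.
Qed.

Lemma msum_disjoint {S : eqType} N A (B : S -> set T) (s : seq S) : uniq s ->
  (forall b, b \in s -> B b `<=` A) ->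
  (forall b c, b \in s -> c \in s -> b != c -> B b `&` B c = set0) ->
  \sum_(b <- s) msum N (B b) <= msum N A.
Proof.
elim: s A => [|b s IH] A /=; first by rewrite big_nil msum_ge0.
move=> /andP[bs us] sub disj; rewrite big_cons.
have -> : A = B b `|` (A `\` B b).
  by rewrite setDUK//; apply: sub; rewrite inE eqxx.
rewrite msumU; last by rewrite setDIK.
apply: leeD2l; apply: IH => // [c cs z Bz|c d cs ds]; last first.
  by apply: disj; rewrite inE ?cs ?ds orbT.
split; first by apply: (sub c) => //; rewrite inE cs orbT.
move=> bz; have bc : b != c by apply: contraNneq bs => ->.
have := disj b c; rewrite !inE eqxx cs orbT => /(_ isT isT bc)/seteqP[/(_ z) + _].
by apply.
Qed.

Lemma msum_seq N A (s : seq T) : uniq s -> (forall z, z \in s -> A z) ->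
  (forall z, A z -> (0 < N z)%N -> z \in s) ->
  msum N A = \sum_(z <- s) (N z)%:R%:E.
Proof.
move=> us sA As; under eq_bigr do rewrite -msum1.
apply: le_anti; rewrite msum_cover/=; last first.
  by move=> z Az Nz; exists z => //; exact: As.
apply: msum_disjoint => // [z zs _ /= ->|b c _ _ bc]; first exact: sA.
by apply/seteqP; split=> // z /= [-> cb]; rewrite cb eqxx in bc.
Qed.

Lemma msum_support N A : msum N A < +oo -> exists s : seq T,
  uniq s /\ forall z, z \in s <-> A z /\ (0 < N z)%N.
Proof.
move=> Afin; have [fA|iA] := pselect (finite_set (A `&` [set z | (0 < N z)%N])).
  exists (fset_set (A `&` [set z | (0 < N z)%N])); split=> [|z].
    exact: finmap.fset_uniq.
  by rewrite in_fset_set// in_setE.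
exfalso; move: Afin; rewrite ltNge; apply/negP; rewrite negbK.
(* Each point of positive multiplicity contributes at least 1, so an infinite support makes the sum
   exceed every natural number. *)
suff le n : n%:R%:E <= msum N A.
  case E : (msum N A) => [r| |] //.
    have := le (Num.bound `|r|%R); rewrite E lee_fin.
    move=> /(lt_le_trans (archi_boundP (normr_ge0 r))).
    by rewrite ltNge ler_norm.
  by have := le 0%N; rewrite E.
have [X XA cX] := infinite_set_fset n iA.
apply: (@le_trans _ _ (msum N [set` X])); last first.
  by apply: msum_sub => z /XA [].
rewrite (@msum_seq _ _ X) ?finmap.fset_uniq//.
apply: (@le_trans _ _ (\sum_(z <- X) 1)).
  by rewrite sumEFin lee_fin big_const_seq count_predT -Monoid.iteropE ler_nat.
by rewrite big_seq [leRHS]big_seq; apply: lee_sum => z /XA[_ /= Nz]; rewrite lee_fin ler1n.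
Qed.
End Multiplicity.

(** * Existence of the diagram of an r-measure *)

Section Content.
Context {R : realType} (mu : rect R -> \bar R).
Implicit Types (a b c d p q : \bar R).

(* [mu] of the rectangle [a, b] x [c, d], extended by [0] to degenerate
   rectangles so that additivity also holds at the endpoints. *)
Definition content a b c d : \bar R :=
  if pselect (a < b) is left ab then
    if pselect (c < d) is left cd then mu (Rect ab cd) else 0
  else 0.

Lemma content_Rect a b c d (ab : a < b) (cd : c < d) :
  content a b c d = mu (Rect ab cd).
Proof.
rewrite /content; case: pselect => // ab'; case: pselect => // cd'.
by congr (mu (Rect _ _)); exact: Prop_irrelevance.
Qed.

Lemma contentE r : mu r = content (xmin r) (xmax r) (ymin r) (ymax r).
Proof. by case: r => a b c d ab cd; rewrite content_Rect. Qed.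

Lemma content_degx a b c d : b <= a -> content a b c d = 0.
Proof. by rewrite /content; case: pselect => // ab; rewrite leNgt ab. Qed.

Lemma content_degy a b c d : d <= c -> content a b c d = 0.
Proof.
rewrite /content; case: pselect => // ab; case: pselect => // cd.
by rewrite leNgt cd.
Qed.

Hypothesis mu_rmeasure : is_rmeasure mu.

Lemma content_nat a b c d : content a b c d = +oo \/
  exists n : nat, content a b c d = n%:R%:E.
Proof.
rewrite /content; case: pselect => ab; last by right; exists 0%N.
case: pselect => cd; last by right; exists 0%N.
exact: (rmeasure_nat mu_rmeasure).
Qed.

Lemma content_ge0 a b c d : 0 <= content a b c d.
Proof. by case: (content_nat a b c d) => [->//|[n ->]]; rewrite lee_fin. Qed.

Lemma content_splitx a p b c d : a <= p -> p <= b ->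
  content a b c d = content a p c d + content p b c d.
Proof.
rewrite le_eqVlt => /predU1P[<- _|ap]; first by rewrite (content_degx _ _ (lexx a)) add0e.
rewrite le_eqVlt => /predU1P[<-|pb]; first by rewrite (content_degx _ _ (lexx p)) adde0.
have [dc|cd] := leP d c; first by rewrite !content_degy// adde0.
by rewrite (content_Rect (lt_trans ap pb) cd) !content_Rect (rmeasure_splitx mu_rmeasure).
Qed.

Lemma content_splity a b c q d : c <= q -> q <= d ->
  content a b c d = content a b c q + content a b q d.
Proof.
rewrite le_eqVlt => /predU1P[<- _|cq]; first by rewrite (content_degy _ _ (lexx c)) add0e.
rewrite le_eqVlt => /predU1P[<-|qd]; first by rewrite (content_degy _ _ (lexx q)) adde0.
have [ba|ab] := leP b a; first by rewrite !content_degx// adde0.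
by rewrite (content_Rect ab (lt_trans cq qd)) !content_Rect (rmeasure_splity mu_rmeasure).
Qed.

Lemma le_content a b c d a' b' c' d' : a' <= a -> b <= b' -> c' <= c -> d <= d' ->
  content a b c d <= content a' b' c' d'.
Proof.
move=> a'a bb' c'c dd'.
have [ba|/ltW ab] := leP b a; first by rewrite content_degx// content_ge0.
have [dc|/ltW cd] := leP d c; first by rewrite content_degy// content_ge0.
rewrite (@content_splitx a' a b')//; last exact: le_trans bb'.
rewrite (@content_splitx a b b')// (@content_splity a b c' c d')//;
  last exact: le_trans dd'.
rewrite (@content_splity a b c d d')//.
apply: le_trans (leeDr _ (content_ge0 _ _ _ _)).
apply: le_trans (leeDl _ (content_ge0 _ _ _ _)).
apply: le_trans (leeDr _ (content_ge0 _ _ _ _)).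
exact: leeDl (content_ge0 _ _ _ _).
Qed.

Lemma dbox_finite_rinterior a b c d : content a b c d < +oo ->
  dbox a b c d `<=` finite_rinterior mu.
Proof.
move=> fin z zR; have [az bz cz dz] := zR.
exists (Rect (below_lt az bz) (below_lt cz dz)); first by rewrite -content_Rect.
by rewrite dpointsE.
Qed.

Lemma finite_rinteriorE z : finite_rinterior mu z <->
  exists a b c d, content a b c d < +oo /\ dbox a b c d z.
Proof.
split=> [[r]|[a [b [c [d [fin zR]]]]]]; last exact: dbox_finite_rinterior fin _ zR.
by rewrite contentE dpointsE => fin zR; exists (xmin r), (xmax r), (ymin r), (ymax r).
Qed.

(** The multiplicity is the least measure of a rectangle around [z]. The values being natural
    numbers or [+oo], the minimum is attained and no limit is involved. *)
Definition is_multiplicity (z : dpoint R) (n : nat) :=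
  (exists a b c d, dbox a b c d z /\ content a b c d = n%:R%:E) /\
  forall a b c d, dbox a b c d z -> n%:R%:E <= content a b c d.

Lemma multiplicity_exists z : finite_rinterior mu z -> exists n, is_multiplicity z n.
Proof.
move=> /finite_rinteriorE[a [b [c [d [fin zR]]]]].
have ex : exists n, `[< exists a b c d, dbox a b c d z /\ content a b c d = n%:R%:E >].
  case: (content_nat a b c d) => [E|[n E]]; first by rewrite E in fin.
  by exists n; apply/asboolP; exists a, b, c, d.
case: (ex_minnP ex) => n /asboolP nP nmin; exists n; split=> // a' b' c' d' zR'.
case: (content_nat a' b' c' d') => [->|[k E]]; first exact: leey.
rewrite E lee_fin ler_nat; apply: nmin; apply/asboolP.
by exists a', b', c', d'.
Qed.

Section Diagram.
Variable D : dpoint R -> nat.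
Hypothesis D_mult : forall z, finite_rinterior mu z -> is_multiplicity z (D z).

(** Quantifying over all subrectangles makes the property hereditary, as [dbox_tube] requires. *)
Definition counted a b c d := content a b c d < +oo /\
  forall a' b' c' d', a <= a' -> b' <= b -> c <= c' -> d' <= d ->
    msum D (dbox a' b' c' d') = content a' b' c' d'.

Lemma counted_sub a b c d a' b' c' d' :
  a <= a' -> b' <= b -> c <= c' -> d' <= d ->
  counted a b c d -> counted a' b' c' d'.
Proof.
move=> aa' b'b cc' d'd [fin cnt]; split.
  by apply: le_lt_trans fin; exact: le_content.
move=> a1 b1 c1 d1 a'a1 b1b' c'c1 d1d'; apply: cnt.
- exact: le_trans a'a1.
- exact: le_trans b'b.
- exact: le_trans c'c1.
- exact: le_trans d'd.
Qed.

Lemma counted_addx a p b c d : a <= p -> p <= b ->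
  counted a p c d -> counted p b c d -> counted a b c d.
Proof.
move=> ap pb [fl cl] [fr cr]; split.
  by rewrite (content_splitx _ _ ap pb) lte_add_pinfty.
move=> a' b' c' d' aa' b'b cc' d'd.
have [b'p|/ltW pb'] := leP b' p; first exact: cl.
have [pa'|/ltW a'p] := leP p a'; first exact: cr.
rewrite (content_splitx _ _ a'p pb') -cl// -cr// -msumU; last first.
  by apply/seteqP; split=> // z [[_ /negP ? _ _] []].
apply: eq_msum => z _; split=> [[az bz cz dz]|[]].
- by have [pz|pz] := boolP (below p z.1); [right|left].
- by move=> [az pz cz dz]; split=> //; exact: contra (below_anti pb') pz.
- by move=> [az pz cz dz]; split=> //; exact: below_anti az.
Qed.

Lemma counted_addy a b c q d : c <= q -> q <= d ->
  counted a b c q -> counted a b q d -> counted a b c d.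
Proof.
move=> cq qd [fl cl] [fr cr]; split.
  by rewrite (content_splity _ _ cq qd) lte_add_pinfty.
move=> a' b' c' d' aa' b'b cc' d'd.
have [d'q|/ltW qd'] := leP d' q; first exact: cl.
have [qc'|/ltW c'q] := leP q c'; first exact: cr.
rewrite (content_splity _ _ c'q qd') -cl// -cr// -msumU; last first.
  by apply/seteqP; split=> // z [[_ _ _ /negP ?] []].
apply: eq_msum => z _; split=> [[az bz cz dz]|[]].
- by have [qz|qz] := boolP (below q z.2); [right|left].
- by move=> [az bz cz qz]; split=> //; exact: contra (below_anti qd') qz.
- by move=> [az bz cz dz]; split=> //; exact: below_anti cz.
Qed.

(* In a rectangle of least measure around [z], every piece of a subdivision
   that misses [z] has measure zero. *)
Lemma counted_local z : finite_rinterior mu z ->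
  exists a b c d, dbox a b c d z /\ counted a b c d.
Proof.
move=> zF; have [[a [b [c [d [zR RE]]]]] zmin] := D_mult zF.
exists a, b, c, d; split=> //.
have fin : content a b c d < +oo by rewrite RE ltry.
split=> // a' b' c' d' aa' b'b cc' d'd.
have [az bz cz dz] := zR.
(* A piece that still contains [z] already carries the whole measure; since this is finite, the
   complementary piece carries none. *)
have zeroR X Y : content a b c d = X + Y -> (D z)%:R%:E <= X -> 0 <= Y -> Y = 0.
  rewrite RE; case: X Y => [x| |] [y| |]//=; rewrite -?EFinD.
  by move=> [->]; rewrite !lee_fin => ? ?; congr EFin; lra.
have zero a1 b1 c1 d1 : a <= a1 -> b1 <= b -> c <= c1 -> d1 <= d ->
    ~ dbox a1 b1 c1 d1 z -> content a1 b1 c1 d1 = 0.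
  move=> aa1 b1b cc1 d1d zR1.
  have [b1a1|ab1] := leP b1 a1; first exact: content_degx.
  have [d1c1|cd1] := leP d1 c1; first exact: content_degy.
  have a1b := ltW (lt_le_trans ab1 b1b); have ab := le_trans aa1 (ltW ab1).
  have c1d := ltW (lt_le_trans cd1 d1d); have cd := le_trans cc1 (ltW cd1).
  suff [Y YE leY] : exists2 Y, Y = 0 & content a1 b1 c1 d1 <= Y.
    by apply: le_anti; rewrite -{1}YE leY content_ge0.
  have [a1z|a1z] := boolP (below a1 z.1); last first.
    exists (content a1 b c d); last exact: le_content.
    by apply: (zeroR (content a a1 c d)); rewrite -?content_splitx ?content_ge0 ?zmin.
  have [b1z|b1z] := boolP (below b1 z.1).
    exists (content a b1 c d); last exact: le_content.
    by apply: (zeroR (content b1 b c d)); rewrite 1?addeC -?content_splitx ?content_ge0 ?zmin.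
  have [c1z|c1z] := boolP (below c1 z.2); last first.
    exists (content a b c1 d); last exact: le_content.
    by apply: (zeroR (content a b c c1)); rewrite -?content_splity ?content_ge0 ?zmin.
  have [d1z|d1z] := boolP (below d1 z.2); last by case: zR1.
  exists (content a b c d1); last exact: le_content.
  by apply: (zeroR (content a b d1 d)); rewrite 1?addeC -?content_splity ?content_ge0 ?zmin.
(* Some coordinate line separates [w] from [z]. The piece on the side of [w] has measure zero, which
   bounds the multiplicity of [w]. *)
have D0 w : dbox a b c d w -> w != z -> D w = 0%N.
  move=> wR wz; have [_ wmin] := D_mult (dbox_finite_rinterior fin wR).
  have [aw bw cw dw] := wR.
  suff [a1 [b1 [c1 [d1 [w1 E]]]]] : exists a1 b1 c1 d1,
      dbox a1 b1 c1 d1 w /\ content a1 b1 c1 d1 = 0.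
    by have := wmin _ _ _ _ w1; rewrite E lee_fin lern0 => /eqP.
  have [wz1|/decorated_separated[p]] := eqVneq w.1 z.1; last first.
    have [pw|pw] := boolP (below p w.1); have [pz|pz] //= := boolP (below p z.1).
      move=> _; exists p, b, c, d; split=> //; apply: zero => //.
        exact: ltW (below_lt az pz).
      by case; rewrite (negPf pz).
    move=> _; exists a, p, c, d; split=> //; apply: zero => //.
      exact: ltW (below_lt pz bz).
    by case=> _; rewrite pz.
  have [wz2|/decorated_separated[p]] := eqVneq w.2 z.2.
    by case/eqP: wz; rewrite [LHS]surjective_pairing wz1 wz2 -surjective_pairing.
  have [pw|pw] := boolP (below p w.2); have [pz|pz] //= := boolP (below p z.2).
    move=> _; exists a, b, p, d; split=> //; apply: zero => //.
      exact: ltW (below_lt cz pz).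
    by case=> _ _; rewrite (negPf pz).
  move=> _; exists a, b, c, p; split=> //; apply: zero => //.
    exact: ltW (below_lt pz dz).
  by case=> _ _ _; rewrite pz.
have [zR'|zR'] := pselect (dbox a' b' c' d' z).
  transitivity ((D z)%:R%:E : \bar R).
    rewrite -msum1; apply: eq_msum => w Dw; split=> [wR'|->//].
    apply/eqP/negPn/negP => wz; move: Dw; rewrite D0//.
    exact: dbox_sub wR'.
  by apply: le_anti; rewrite zmin//= -RE le_content.
rewrite (zero a' b' c' d')//; apply: esum1 => w wR'.
rewrite D0//; first exact: dbox_sub wR'.
by apply: contra_notN zR' => /eqP <-.
Qed.

Lemma counted_rect a b c d : a < b -> c < d ->
  dbox a b c d `<=` finite_rinterior mu -> counted a b c d.
Proof.
move=> ab cd RF; apply: dbox_tube => //.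
- by move=> ? ? ? ? ? ? ? ?; exact: counted_sub.
- exact: counted_addx.
- exact: counted_addy.
- by move=> z /RF/counted_local.
Qed.
End Diagram.

Lemma Dgm_exists : exists D, is_Dgm mu D.
Proof.
have /choice[D DP] : forall z, exists n : nat,
    (finite_rinterior mu z -> is_multiplicity z n) /\
    (~ finite_rinterior mu z -> n = 0%N).
  move=> z; have [zF|zF] := pselect (finite_rinterior mu z).
    by have [n nP] := multiplicity_exists zF; exists n.
  by exists 0%N.
have cnt r : dpoints r `<=` finite_rinterior mu ->
    counted D (xmin r) (xmax r) (ymin r) (ymax r).
  rewrite dpointsE; apply: counted_rect (xmin_lt_xmax r) (ymin_lt_ymax r) => z.
  exact: (DP z).1.
exists D; split.
- move=> z Dz; apply: contrapT => zF.
  by rewrite ((DP z).2 zF) in Dz.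
- by move=> r /cnt[fin cnt_r]; rewrite /card_in dpointsE -/(msum _ _) cnt_r.
- by move=> r /cnt[fin cnt_r]; rewrite /card_in dpointsE -/(msum _ _) cnt_r// contentE.
Qed.

Lemma Dgm_msum a b c d : content a b c d < +oo ->
  msum (Dgm mu) (dbox a b c d) = content a b c d.
Proof.
have DgmP : is_Dgm mu (Dgm mu) := xgetPex _ Dgm_exists.
move=> fin; have RF := dbox_finite_rinterior fin.
have [ba|ab] := leP b a.
  rewrite content_degx//; apply: esum1 => z [az bz _ _]; exfalso.
  by have := below_lt az bz; rewrite ltNge ba.
have [dc|cd] := leP d c.
  rewrite content_degy//; apply: esum1 => z [_ _ cz dz]; exfalso.
  by have := below_lt cz dz; rewrite ltNge dc.
have := Dgm_card DgmP (r := Rect ab cd).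
by rewrite /card_in dpointsE/= contentE -/(msum _ _); apply.
Qed.
End Content.

(** * Relative interiors of rectangles *)

Section Surround.
Context {R : realType}.
Implicit Types (a b c d p q s t x y : \bar R).

(* [p] lies in the interior, relative to the extended line, of an interval with
   bounds [a] and [b]: an infinite bound belongs to this interior. *)
Definition slb a p := (a < p) || (a == -oo).
Definition sub b p := (p < b) || (b == +oo).

Lemma slb_le a p : slb a p -> a <= p.
Proof. by case/orP => [/ltW//|/eqP ->]; exact: leNye. Qed.

Lemma sub_ge b p : sub b p -> p <= b.
Proof. by case/orP => [/ltW//|/eqP ->]; exact: leey. Qed.

Lemma slb_trans a p q : slb a p -> p <= q -> slb a q.
Proof. by move=> /orP[ap pq|/eqP ->]; rewrite /slb ?eqxx ?orbT// (lt_le_trans ap pq). Qed.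

Lemma sub_trans b p q : sub b p -> q <= p -> sub b q.
Proof. by move=> /orP[pb qp|/eqP ->]; rewrite /sub ?eqxx ?orbT// (le_lt_trans qp pb). Qed.

Lemma slb_max a a' p : slb a p -> slb a' p -> slb (Order.max a a') p.
Proof. by case: (leP a a'). Qed.

Lemma sub_min b b' p : sub b p -> sub b' p -> sub (Order.min b b') p.
Proof. by case: (leP b b'). Qed.

Lemma slb_sub_lt a b p q : slb a p -> p <= q -> sub b q -> a < b.
Proof.
move=> /orP[ap|/eqP->] pq /orP[qb|/eqP->]; rewrite ?ltNyy//.
- exact: lt_trans (lt_le_trans ap pq) qb.
- exact: lt_le_trans (lt_le_trans ap pq) (leey q).
- exact: le_lt_trans (leNye q) qb.
Qed.

(** The bound [a] is raised past the finitely many listed values below [p]; if [p] is [-oo], nothing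
    lies below it and [a] can stay. *)
Lemma slb_squeeze (s : seq \bar R) a p : slb a p ->
  exists a', [/\ a <= a', slb a' p & forall v, v \in s -> a' <= v -> p <= v].
Proof.
move=> slb_a; have [pE|pNy] := eqVneq p -oo.
  by exists a; split=> // v _ _; rewrite pE leNye.
have ap : a < p.
  by case/orP: slb_a => // /eqP ->; rewrite ltNye.
elim: s => [|v s [a' [aa' a'p sP]]]; first by exists a; rewrite /slb ap.
have {}a'p : a' < p by case/orP: a'p => // /eqP ->; rewrite ltNye.
have [pv|vp] := leP p v.
  exists a'; rewrite /slb a'p; split=> // u; rewrite inE => /predU1P[->//|]; exact: sP.
have [a1] : exists2 z, Order.max a' v < z & z < p.
  by apply: ereal_between; rewrite gt_max a'p vp.
rewrite gt_max => /andP[a'a1 va1] a1p; exists a1; rewrite /slb a1p.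
split=> //; first exact: ltW (le_lt_trans aa' a'a1).
move=> u; rewrite inE => /predU1P[->|us a1u]; first by rewrite leNgt va1.
by apply: sP => //; exact: le_trans (ltW a'a1) a1u.
Qed.

Lemma slbN b p : slb (- b) (- p) = sub b p.
Proof. by rewrite /slb /sub lteN2; congr (_ || _); case: b. Qed.

Lemma sub_squeeze (s : seq \bar R) b p : sub b p ->
  exists b', [/\ b' <= b, sub b' p & forall v, v \in s -> v <= b' -> v <= p].
Proof.
rewrite -slbN => /(slb_squeeze (map -%E s))[a [ba ap sP]].
exists (- a); rewrite -slbN oppeK; split=> // [|v vs va]; first by rewrite leeNl.
by rewrite -leeN2; apply: sP; [exact: map_f|rewrite leeNr].
Qed.

(** Half the gap works for real numbers. If [a] or [p] is infinite any margin does, since infinities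
    absorb it. *)
Lemma slb_margin a p : slb a p -> exists2 e : R, (0 < e)%R & slb a (p - e%:E).
Proof.
case/orP => [|/eqP ->]; last by exists 1%R; rewrite // /slb eqxx orbT.
case: a p => [a| |] [p| |]//; rewrite ?lte_fin.
- move=> ap; exists ((p - a) / 2)%R; rewrite /slb -?EFinB ?lte_fin; first lra.
  by apply/orP; left; lra.
- by move=> _; exists 1%R; rewrite // /slb ltry.
- by move=> _; exists 1%R; rewrite // /slb eqxx orbT.
- by move=> _; exists 1%R; rewrite // /slb eqxx orbT.
Qed.

Lemma sub_margin b p : sub b p -> exists2 e : R, (0 < e)%R & sub b (p + e%:E).
Proof.
rewrite -slbN => /slb_margin[e e0 bpe]; exists e => //.
by rewrite -slbN oppeD// fin_num_adde_defl.
Qed.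

Definition surrounds a b c d p q s t := [/\ slb a p, sub b q, slb c s & sub d t].

Lemma open_slb a : open [set x | slb a x].
Proof.
have [->|aNy] := eqVneq a -oo.
  rewrite (_ : [set x | _] = setT); first exact: openT.
  by apply/seteqP; split=> // x _; rewrite /slb/= eqxx orbT.
rewrite (_ : [set x | _] = [set x | a < x]); first exact: open_ereal_gt_ereal.
by apply/seteqP; split=> x; rewrite /slb/= (negPf aNy) orbF.
Qed.

Lemma open_sub b : open [set x | sub b x].
Proof.
have [->|bNy] := eqVneq b +oo.
  rewrite (_ : [set x | _] = setT); first exact: openT.
  by apply/seteqP; split=> // x _; rewrite /sub/= eqxx orbT.
rewrite (_ : [set x | _] = [set x | x < b]); first exact: open_ereal_lt_ereal.
by apply/seteqP; split=> x; rewrite /sub/= (negPf bNy) orbF.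
Qed.

Lemma nbhs_lt (A : set \bar R) p : nbhs p A -> p != -oo -> exists2 x, A x & x < p.
Proof.
case: p => [p| |]//.
- move=> [e /= e0 eA] _; exists (p - e / 2)%:E; last by rewrite lte_fin; lra.
  by apply: eA => /=; rewrite opprB addrCA subrr addr0 gtr0_norm; lra.
- move=> [M [Mr MA]] _; exists (M + 1)%:E; last exact: ltry.
  by apply: MA; rewrite lte_fin; lra.
Qed.

Lemma nbhs_gt (A : set \bar R) p : nbhs p A -> p != +oo -> exists2 x, A x & p < x.
Proof.
case: p => [p| |]//.
- move=> [e /= e0 eA] _; exists (p + e / 2)%:E; last by rewrite lte_fin; lra.
  by apply: eA => /=; rewrite opprD addrA subrr add0r normrN gtr0_norm; lra.
- move=> [M [Mr MA]] _; exists (M - 1)%:E; last exact: ltNyr.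
  by apply: MA; rewrite lte_fin; lra.
Qed.

(** A neighbourhood of a finite endpoint crosses it, so such an endpoint is not interior; beyond an
    infinite endpoint there is nothing to cross into. *)
Lemma interior_rectE (r : rect R) z : (rect_set r)° z <->
  surrounds (xmin r) (xmax r) (ymin r) (ymax r) z.1 z.1 z.2 z.2.
Proof.
case: z => x y; split=> [|[ax bx cy dy]].
  move=> [[A B] [/= nA nB] AB].
  have inA x' : A x' -> xmin r <= x' <= xmax r.
    move=> Ax'; have /= := AB (x', y) (conj Ax' (nbhs_singleton nB)).
    by case; rewrite /= in_itv.
  have inB y' : B y' -> ymin r <= y' <= ymax r.
    move=> By'; have /= := AB (x, y') (conj (nbhs_singleton nA) By').
    by case=> _; rewrite /= in_itv.
  have /andP[ax xb] := inA _ (nbhs_singleton nA).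
  have /andP[cy yd] := inB _ (nbhs_singleton nB).
  rewrite /surrounds /slb /sub /=; split; rewrite lt_neqAle ?ax ?xb ?cy ?yd andbT.
  - apply/orP; have [xE|//] := eqVneq (xmin r) x; last by left.
    right; apply/negPn/negP => xNy; have [|x' /inA/andP[+ _]] := nbhs_lt nA.
      by rewrite -xE.
    by rewrite xE leNgt => /negP.
  - apply/orP; have [xE|//] := eqVneq x (xmax r); last by left.
    right; apply/negPn/negP => xNy; have [|x' /inA/andP[_ +]] := nbhs_gt nA.
      by rewrite xE.
    by rewrite -xE leNgt => /negP.
  - apply/orP; have [yE|//] := eqVneq (ymin r) y; last by left.
    right; apply/negPn/negP => yNy; have [|y' /inB/andP[+ _]] := nbhs_lt nB.
      by rewrite -yE.
    by rewrite yE leNgt => /negP.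
  - apply/orP; have [yE|//] := eqVneq y (ymax r); last by left.
    right; apply/negPn/negP => yNy; have [|y' /inB/andP[_ +]] := nbhs_gt nB.
      by rewrite yE.
    by rewrite -yE leNgt => /negP.
exists ([set x | slb (xmin r) x] `&` [set x | sub (xmax r) x],
        [set y | slb (ymin r) y] `&` [set y | sub (ymax r) y]); last first.
  move=> [x' y'] [/= [ax' bx'] [cy' dy']]; split; rewrite /= in_itv /=.
    by rewrite slb_le// sub_ge.
  by rewrite slb_le// sub_ge.
by split; apply: filterI; apply: open_nbhs_nbhs; split=> //;
  (exact: open_slb || exact: open_sub).
Qed.
End Surround.

(** * Undecorated diagrams and closed boxes *)

Section Undecorated.
Context {R : realType}.
Implicit Types a b c d p q s t x y : \bar R.
Local Notation point := (\bar R * \bar R)%type.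

(** The delicate case is the point [-oo] with [a = -oo]: its only decoration is [-oo^+], which lies
    above [-oo]. *)
Lemma slb_below a (w : decorated R) : slb a (undecorate w) -> below a w.
Proof.
rewrite belowE => /orP[->//|/eqP->].
have [wNy|/=] := eqVneq -oo (undecorate w); last by rewrite eq_sym -ltNye => ->.
case: w wNy => -[x [|]] wP; rewrite /undecorate /= => xE; first by rewrite orbT.
by rewrite -xE eqxx in wP.
Qed.

Lemma sub_below b (w : decorated R) : sub b (undecorate w) -> ~~ below b w.
Proof.
rewrite belowE negb_or -leNgt => /orP[wb|/eqP->].
  by rewrite (ltW wb) gt_eqF.
rewrite leey /=; case: w => -[x [|]] wP; rewrite /undecorate /= ?andbF// andbT.
by apply: contraTN wP => /eqP <-; rewrite eqxx andbF.
Qed.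

Definition cbox p q s t : set point := [set z | p <= z.1 <= q /\ s <= z.2 <= t].

Lemma undecorate_cbox a b c d p q s t : surrounds a b c d p q s t ->
  undecorate_point @^-1` cbox p q s t `<=` dbox a b c d.
Proof.
move=> [ap bq cs dt] w [/= /andP[pw wq] /andP[sw wt]]; split.
- exact: slb_below (slb_trans ap pw).
- exact: sub_below (sub_trans bq wq).
- exact: slb_below (slb_trans cs sw).
- exact: sub_below (sub_trans dt wt).
Qed.

Lemma dbox_undecorate a b c d : dbox a b c d `<=` undecorate_point @^-1` cbox a b c d.
Proof.
move=> w [aw bw cw dw]; split; rewrite /= ?(below_le aw) ?(below_le cw) /=.
  exact: nbelow_le.
exact: nbelow_le.
Qed.

Lemma finite_fiber (z : point) : finite_set [set w | undecorate_point w = z].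
Proof.
pose f (w : dpoint R) := (val w.1, val w.2).
pose g (bb : bool * bool) := ((z.1, bb.1), (z.2, bb.2)).
have -> : [set w | undecorate_point w = z] = f @^-1` (g @` setT).
  apply/seteqP; split=> [w /= wz|w [[b1 b2] _]].
    exists ((val w.1).2, (val w.2).2) => //.
    by rewrite /g -wz /f /undecorate_point /undecorate /= -!surjective_pairing.
  move=> /= [E1 E2]; rewrite /undecorate_point /undecorate /=.
  by rewrite -E1 -E2 -surjective_pairing.
apply: finite_preimage; last by apply: finite_image; exact: finite_finset.
move=> [u v] [u' v'] _ _ [uu' vv'].
by congr pair; exact: val_inj.
Qed.

Section Single.
Variable mu : rect R -> \bar R.
Hypothesis mu_rmeasure : is_rmeasure mu.
Local Notation m := (content mu).

Lemma finite_interiorE (z : point) : finite_interior mu z <->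
  exists a b c d, m a b c d < +oo /\ surrounds a b c d z.1 z.1 z.2 z.2.
Proof.
split=> [[r fin /interior_rectE zr]|[a [b [c [d [fin sur]]]]]].
  by exists (xmin r), (xmax r), (ymin r), (ymax r); rewrite -contentE.
have [az bz cz dz] := sur.
have ab := slb_sub_lt az (lexx _) bz; have cd := slb_sub_lt cz (lexx _) dz.
exists (Rect ab cd); first by rewrite -content_Rect.
exact/interior_rectE.
Qed.

Lemma surrounds_finite_interior a b c d p q s t : m a b c d < +oo ->
  surrounds a b c d p q s t -> cbox p q s t `<=` finite_interior mu.
Proof.
move=> fin [ap bq cs dt] z [/andP[pz zq] /andP[sz zt]]; apply/finite_interiorE.
exists a, b, c, d; split=> //; split.
- exact: slb_trans ap pz.
- exact: sub_trans bq zq.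
- exact: slb_trans cs sz.
- exact: sub_trans dt zt.
Qed.

(** Compactness, first along a vertical segment and then across the segments. Two adjacent
    rectangles are cut down to a common width or height, and additivity keeps the measure of their
    union finite. *)
Lemma cbox_surrounded p q s t : p <= q -> s <= t ->
  cbox p q s t `<=` finite_interior mu ->
  exists a b c d, m a b c d < +oo /\ surrounds a b c d p q s t.
Proof.
move=> pq st KF.
have at_point x y : p <= x -> x <= q -> s <= y -> y <= t ->
    exists a b c d, m a b c d < +oo /\ surrounds a b c d x x y y.
  move=> px xq sy yt; apply/(finite_interiorE (x, y)); apply: KF.
  by split; rewrite /= ?px ?sy.
have column x : p <= x -> x <= q ->
    exists a b c d, m a b c d < +oo /\ surrounds a b c d x x s t.
  move=> px xq; move: (st); rewrite le_eqVlt => /predU1P[<-|st'].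
    exact: at_point.
  apply: (interval_induction (Q := fun s t => exists a b c d,
    m a b c d < +oo /\ surrounds a b c d x x s t)) st'.
  - move=> s1 y t1 _ s1y yt1 _ [a1 [b1 [c1 [d1 [f1 [ax1 bx1 cs1 dy1]]]]]].
    move=> [a2 [b2 [c2 [d2 [f2 [ax2 bx2 cy2 dt2]]]]]].
    exists (Order.max a1 a2), (Order.min b1 b2), c1, d2; split; last first.
      by split=> //; [exact: slb_max|exact: sub_min].
    rewrite (@content_splity _ _ mu_rmeasure _ _ c1 y); last 2 first.
    + exact: le_trans (slb_le cs1) (ltW s1y).
    + exact: le_trans (ltW yt1) (sub_ge dt2).
    apply: lte_add_pinfty.
      apply: le_lt_trans f1; apply: le_content => //.
      * by rewrite le_max lexx.
      * by rewrite ge_min lexx.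
      * exact: sub_ge.
    apply: le_lt_trans f2; apply: le_content => //.
    * by rewrite le_max lexx orbT.
    * by rewrite ge_min lexx orbT.
    * exact: slb_le.
  - move=> y sy yt; have [a [b [c [d [fin [ax bx cy dy]]]]]] :=
      at_point x y px xq sy (ltW yt).
    have yd : y < d by case/orP: dy => // /eqP ->; exact: lt_le_trans yt (leey t).
    have [y' yy' y'd] := ereal_between yd.
    exists y' => // z yz zy' _; exists a, b, c, d; split=> //; split=> //.
    by rewrite /sub (le_lt_trans zy' y'd).
  - move=> y sy yt; have [a [b [c [d [fin [ax bx cy dy]]]]]] :=
      at_point x y px xq (ltW sy) yt.
    have cy' : c < y by case/orP: cy => // /eqP ->; exact: le_lt_trans (leNye s) sy.
    have [y' yy' y'd] := ereal_between cy'.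
    exists y' => // z yz zy' _; exists a, b, c, d; split=> //; split=> //.
    by rewrite /slb (lt_le_trans yy' yz).
move: (pq); rewrite le_eqVlt => /predU1P[<-|pq']; first exact: column.
apply: (interval_induction (Q := fun p q => exists a b c d,
  m a b c d < +oo /\ surrounds a b c d p q s t)) pq'.
- move=> p1 x q1 _ p1x xq1 _ [a1 [b1 [c1 [d1 [f1 [ap1 bx1 cs1 dt1]]]]]].
  move=> [a2 [b2 [c2 [d2 [f2 [ax2 bq2 cs2 dt2]]]]]].
  exists a1, b2, (Order.max c1 c2), (Order.min d1 d2); split; last first.
    by split=> //; [exact: slb_max|exact: sub_min].
  rewrite (@content_splitx _ _ mu_rmeasure a1 x); last 2 first.
  + exact: le_trans (slb_le ap1) (ltW p1x).
  + exact: le_trans (ltW xq1) (sub_ge bq2).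
  apply: lte_add_pinfty.
    apply: le_lt_trans f1; apply: le_content => //.
    * exact: sub_ge.
    * by rewrite le_max lexx.
    * by rewrite ge_min lexx.
  apply: le_lt_trans f2; apply: le_content => //.
  * exact: slb_le.
  * by rewrite le_max lexx orbT.
  * by rewrite ge_min lexx orbT.
- move=> x px xq; have [a [b [c [d [fin [ax bx cs dt]]]]]] := column x px (ltW xq).
  have xb : x < b by case/orP: bx => // /eqP ->; exact: lt_le_trans xq (leey q).
  have [x' xx' x'b] := ereal_between xb.
  exists x' => // z xz zx' _; exists a, b, c, d; split=> //; split=> //.
  by rewrite /sub (le_lt_trans zx' x'b).
- move=> x px xq; have [a [b [c [d [fin [ax bx cs dt]]]]]] := column x (ltW px) xq.
  have ax' : a < x by case/orP: ax => // /eqP ->; exact: le_lt_trans (leNye p) px.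
  have [x' xx' x'b] := ereal_between ax'.
  exists x' => // z xz zx' _; exists a, b, c, d; split=> //; split=> //.
  by rewrite /slb (lt_le_trans xx' xz).
Qed.

Lemma dgm_fiber z : finite_interior mu z ->
  (dgm mu z)%:R%:E = msum (Dgm mu) [set w | undecorate_point w = z] :> \bar R.
Proof.
move=> zF; rewrite /dgm mem_set//.
have fz := finite_fiber z.
rewrite (@msum_seq _ _ _ _ (fset_set [set w | undecorate_point w = z])).
- by rewrite fsbig_finite// natr_sum sumEFin.
- exact: finmap.fset_uniq.
- by move=> w; rewrite in_fset_set// in_setE.
- by move=> w wz _; rewrite in_fset_set// in_setE.
Qed.

Lemma dgm_msum (U : set point) : U `<=` finite_interior mu ->
  msum (dgm mu) U = msum (Dgm mu) (undecorate_point @^-1` U) :> \bar R.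
Proof.
move=> UF; rewrite {1}/msum.
under eq_esum => z Uz do rewrite (dgm_fiber (UF z Uz)).
rewrite esum_esum; last by move=> *; exact: msum_term_ge0.
rewrite /msum (@reindex_esum _ _ _
  (U `*`` fun z => [set w | undecorate_point w = z]) _ snd)//.
split.
- by move=> [z w] [/= Uz wz]; rewrite wz.
- by move=> [z w] [z' w'] /set_mem[/= _ <-] /set_mem[/= _ <-] /= ->.
- by move=> w Uw; exists (undecorate_point w, w).
Qed.

Lemma dgm_le_content a b c d p q s t : m a b c d < +oo ->
  surrounds a b c d p q s t -> msum (dgm mu) (cbox p q s t) <= m a b c d.
Proof.
move=> fin sur; rewrite dgm_msum; last exact: surrounds_finite_interior sur.
by rewrite -(Dgm_msum mu_rmeasure fin); apply: msum_sub; exact: undecorate_cbox.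
Qed.

(** A surrounding rectangle of finite measure carries finitely many diagram points, so its sides can
    be moved inwards past the coordinates of those outside the closed box. *)
Lemma content_le_dgm p q s t : p <= q -> s <= t ->
  cbox p q s t `<=` finite_interior mu ->
  exists a b c d, [/\ m a b c d < +oo, surrounds a b c d p q s t &
    m a b c d <= msum (dgm mu) (cbox p q s t)].
Proof.
move=> pq st KF; have [a0 [b0 [c0 [d0 [fin0 [ap bq cs dt]]]]]] :=
  cbox_surrounded pq st KF.
have [S [_ SP]] : exists S : seq (dpoint R), uniq S /\
    forall w : dpoint R, w \in S <-> dbox a0 b0 c0 d0 w /\ (0 < Dgm mu w)%N.
  by apply: (@msum_support R); rewrite Dgm_msum.
pose S1 := [seq undecorate w.1 | w <- S]; pose S2 := [seq undecorate w.2 | w <- S].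
have [a [a0a {}ap aS]] := slb_squeeze S1 ap.
have [b [bb0 {}bq bS]] := sub_squeeze S1 bq.
have [c [c0c {}cs cS]] := slb_squeeze S2 cs.
have [d [dd0 {}dt dS]] := sub_squeeze S2 dt.
have fin : m a b c d < +oo.
  by apply: le_lt_trans fin0; exact: le_content.
exists a, b, c, d; split=> //.
rewrite dgm_msum// -(Dgm_msum mu_rmeasure fin); apply: le_msum => w wR Dw.
have [/andP[aw wb] /andP[cw wd]] := dbox_undecorate wR.
have wS : w \in S by apply/SP; split=> //; exact: dbox_sub wR.
have w1 : undecorate w.1 \in S1 by apply/mapP; exists w.
have w2 : undecorate w.2 \in S2 by apply/mapP; exists w.
by split; rewrite /= ?aS ?bS ?cS ?dS.
Qed.
End Single.
End Undecorated.

(** * Balls *)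

Section Balls.
Context {R : realType}.
Implicit Types (p q s t : \bar R) (e : R).
Local Notation point := (\bar R * \bar R)%type.
Implicit Types (z w : point).

Definition dball z e : set point :=
  cbox (z.1 - e%:E) (z.1 + e%:E) (z.2 - e%:E) (z.2 + e%:E).

Lemma coord_dist_le p q e : (0 <= e)%R ->
  (coord_dist p q <= e%:E) = (p - e%:E <= q <= p + e%:E).
Proof.
move=> e0; rewrite /coord_dist; case: eqVneq => [<-|].
  by rewrite lee_fin e0 leeDl ?lee_fin// leeBlDr// leeDl ?lee_fin.
case: p q => [p| |] [q| |]//=; rewrite ?leNye ?leey ?andbT ?andbF//=.
by move=> _; rewrite -?EFinB -?EFinD !lee_fin ler_distlC.
Qed.

Lemma dinfty_le z w e : (0 <= e)%R -> dinfty z w <= e%:E <-> dball z e w.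
Proof.
move=> e0; rewrite /dinfty ge_max !coord_dist_le// /dball /cbox /=.
by split=> [/andP[]|[-> ->]].
Qed.

Lemma dball_sym z w e : (0 <= e)%R -> dball z e w -> dball w e z.
Proof.
have sym p q : p - e%:E <= q <= p + e%:E -> q - e%:E <= p <= q + e%:E.
  by move=> /andP[pq qp]; rewrite leeBlDr// qp -leeBlDr.
by move=> e0 [/sym ? /sym ?].
Qed.

Lemma dball_trans z w v e e' : dball z e w -> dball w e' v -> dball z (e + e') v.
Proof.
have tr p q t : p - e%:E <= q <= p + e%:E -> q - e'%:E <= t <= q + e'%:E ->
    p - (e + e')%:E <= t <= p + (e + e')%:E.
  move=> /andP[a b] /andP[c d]; apply/andP; split.
    apply: le_trans c; apply: le_trans (leeB a (lexx _)).
    by rewrite EFinD oppeD// addeA.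
  apply: le_trans d _; apply: le_trans (leeD b (lexx _)) _.
  by rewrite EFinD addeA.
by move=> [a b] [c d]; split; [exact: tr a c|exact: tr b d].
Qed.

Lemma dball_center z e : (0 <= e)%R -> dball z e z.
Proof. by move=> e0; apply/dinfty_le => //; rewrite /dinfty /coord_dist !eqxx maxxx. Qed.

Lemma dball0 z : dball z 0 = [set z].
Proof.
apply/seteqP; split=> [w [] |_ ->]; last exact: dball_center.
rewrite !sube0 !adde0 => /le_anti wz1 /le_anti wz2.
by rewrite [w]surjective_pairing -wz1 -wz2 -surjective_pairing.
Qed.

(** In a coordinate where the points differ, a number strictly between the two values leaves a
    margin on either side, also when one of them is infinite. *)
Lemma dball_separated z w : z != w ->
  exists2 e, (0 < e)%R & forall e', (e' <= e)%R -> dball z e' `&` dball w e' = set0.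
Proof.
have sep p q : p < q -> exists2 e, (0 < e)%R & p + e%:E < q - e%:E.
  move=> /ereal_between[t pt tq].
  have [|e1 e10 pt'] := @sub_margin _ t p; first by rewrite /sub pt.
  have [|e2 e20 qt'] := @slb_margin _ t q; first by rewrite /slb tq.
  exists (Num.min e1 e2); first by rewrite lt_min e10.
  apply: (@le_lt_trans _ _ (p + e1%:E)); first by rewrite leeD2l// lee_fin ge_min lexx.
  apply: (@lt_le_trans _ _ (q - e2%:E)); last by rewrite leeB// lee_fin ge_min lexx orbT.
  apply: (@lt_trans _ _ t).
    by case/orP: pt' => // /eqP tE; rewrite tE ltNge leey in tq.
  by case/orP: qt' => // /eqP tE; rewrite tE ltNge leNye in pt.
have cross p q t e e' : p + e%:E < q - e%:E -> (e' <= e)%R ->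
    t <= p + e'%:E -> q - e'%:E <= t -> False.
  move=> pq e'e tp qt; move: pq; rewrite ltNge => /negP; apply.
  apply: (@le_trans _ _ t).
    by apply: le_trans qt; rewrite leeB// lee_fin.
  by apply: le_trans tp _; rewrite leeD2l// lee_fin.
have far p q : p != q -> exists2 e, (0 < e)%R & forall e' t, (e' <= e)%R ->
    p - e'%:E <= t <= p + e'%:E -> q - e'%:E <= t <= q + e'%:E -> False.
  move=> /lt_total/orP[] /sep[e e0 pq]; exists e => // e' t e'e /andP[a b] /andP[c d].
    exact: cross pq e'e b c.
  exact: cross pq e'e d a.
have [zw1|/far[e e0 He] _] := eqVneq z.1 w.1; last first.
  exists e => // e' e'e; apply/seteqP; split=> // v [[a _] [b _]].
  exact: He e'e a b.
have [zw2 /eqP[]|/far[e e0 He] _] := eqVneq z.2 w.2.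
  by rewrite [z]surjective_pairing zw1 zw2 -surjective_pairing.
exists e => // e' e'e; apply/seteqP; split=> // v [[_ a] [_ b]].
exact: He e'e a b.
Qed.

Lemma common_radius (T : eqType) (s : seq T) (Q : T -> R -> Prop) :
  (forall b, b \in s -> exists2 e, (0 < e)%R & forall e', (e' <= e)%R -> Q b e') ->
  exists2 e, (0 < e)%R & forall e' b, (e' <= e)%R -> b \in s -> Q b e'.
Proof.
elim: s => [_|b s IH H]; first by exists 1%R.
have [|e1 e10 H1] := IH; first by move=> c cs; apply: H; rewrite inE cs orbT.
have [|e2 e20 H2] := H b; first by rewrite inE eqxx.
exists (Num.min e1 e2); first by rewrite lt_min e10.
move=> e' c; rewrite le_min => /andP[e'1 e'2]; rewrite inE => /predU1P[->|].
  exact: H2.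
exact: H1.
Qed.

Lemma dballs_separated (s : seq point) :
  exists2 e, (0 < e)%R & forall e' b c, (e' <= e)%R -> b \in s -> c \in s ->
    b != c -> dball b e' `&` dball c e' = set0.
Proof.
have [|e e0 H] := @common_radius _ s (fun b e' => forall c, c \in s -> b != c ->
  dball b e' `&` dball c e' = set0).
  move=> b bs; have [|e e0 H] := @common_radius _ s (fun c e' => b != c ->
      dball b e' `&` dball c e' = set0).
    move=> c cs; have [->|/dball_separated[e e0 H]] := eqVneq b c.
      by exists 1%R.
    by exists e => // e' e'e _; exact: H.
  by exists e => // e' e'e c cs; exact: H.
by exists e => // e' b c e'e bs cs; exact: H.
Qed.
End Balls.

(** * The box inequality for closed boxes *)

Section Stability.
Context {R : realType}.
Implicit Types (p q s t : \bar R) (e : R).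
Local Notation point := (\bar R * \bar R)%type.
Implicit Types (z w : point) (mu nu : rect R -> \bar R).

Lemma msum_cbox_fin mu p q s t : is_rmeasure mu -> p <= q -> s <= t ->
  cbox p q s t `<=` finite_interior mu -> msum (dgm mu) (cbox p q s t) < +oo :> \bar R.
Proof.
move=> muP pq st /(cbox_surrounded muP pq st)[a [b [c [d [fin sur]]]]].
exact: le_lt_trans (dgm_le_content muP fin sur) fin.
Qed.

(** A tight rectangle around the degenerate box [{z}] has measure at most the multiplicity of [z],
    and it surrounds all sufficiently small balls. *)
Lemma dball_isolated mu z : is_rmeasure mu -> finite_interior mu z ->
  exists2 e, (0 < e)%R & forall e', (e' <= e)%R -> dball z e' `<=` finite_interior mu /\
    msum (dgm mu) (dball z e') <= (dgm mu z)%:R%:E :> \bar R.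
Proof.
move=> muP zF; have zE : cbox z.1 z.1 z.2 z.2 = [set z].
  by rewrite -dball0 /dball !sube0 !adde0.
have [|a [b [c [d [fin sur le]]]]] := content_le_dgm muP (lexx z.1) (lexx z.2).
  by rewrite zE => _ ->.
rewrite zE msum1 in le.
have [az bz cz dz] := sur.
have [e1 e10 az'] := slb_margin az; have [e2 e20 bz'] := sub_margin bz.
have [e3 e30 cz'] := slb_margin cz; have [e4 e40 dz'] := sub_margin dz.
exists (Num.min (Num.min e1 e2) (Num.min e3 e4)); first by rewrite !lt_min e10 e20 e30.
move=> e'; rewrite !le_min => /andP[/andP[e'1 e'2] /andP[e'3 e'4]].
have sur' : surrounds a b c d (z.1 - e'%:E) (z.1 + e'%:E) (z.2 - e'%:E) (z.2 + e'%:E).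
  split.
  - by apply: slb_trans az' _; rewrite leeB// lee_fin.
  - by apply: sub_trans bz' _; rewrite leeD2l// lee_fin.
  - by apply: slb_trans cz' _; rewrite leeB// lee_fin.
  - by apply: sub_trans dz' _; rewrite leeD2l// lee_fin.
split; first exact: surrounds_finite_interior sur'.
exact: le_trans (dgm_le_content muP fin sur') le.
Qed.

(** A tight rectangle around [K] for [nu], moved inwards by [eta], still surrounds the smaller box,
    and thickening restores it; infinite sides do not move. Finiteness is transferred together with
    the count. *)
Lemma cbox_box_inequality mu nu (eta : {nonneg R}) p q s t :
  is_rmeasure mu -> is_rmeasure nu -> (forall r, mu r <= nu (thicken eta r)) ->
  p <= q -> s <= t ->
  let K := cbox (p - eta%:num%:E) (q + eta%:num%:E)
    (s - eta%:num%:E) (t + eta%:num%:E) in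
  K `<=` finite_interior nu ->
  cbox p q s t `<=` finite_interior mu /\
    msum (dgm mu) (cbox p q s t) <= msum (dgm nu) K :> \bar R.
Proof.
move=> muP nuP box pq st K KF; set h := eta%:num%:E in K KF *.
have h0 : 0 <= h by rewrite lee_fin.
have wide x y : x <= y -> x - h <= y + h.
  by move=> xy; apply: leeD => //; apply: (le_trans _ h0); rewrite leeNl oppe0.
have [a [b [c [d [fin [ap bq cs dt] le]]]]] :=
  content_le_dgm nuP (wide _ _ pq) (wide _ _ st) KF.
have slb_shift x y : slb x (y - h) -> slb (x + h) y.
  by rewrite /slb lteBrDr// => /orP[->//|/eqP ->]; rewrite /h /= orbT.
have sub_shift x y : sub x (y + h) -> sub (x - h) y.
  by rewrite /sub lteBrDr// => /orP[->//|/eqP ->]; rewrite /h /= orbT.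
have sur : surrounds (a + h) (b - h) (c + h) (d - h) p q s t.
  by split; [exact: slb_shift|exact: sub_shift|exact: slb_shift|exact: sub_shift].
have [ap' bq' cs' dt'] := sur.
have ab := slb_sub_lt ap' pq bq'; have cd := slb_sub_lt cs' st dt'.
have mu_le : content mu (a + h) (b - h) (c + h) (d - h) <= content nu a b c d.
  rewrite (content_Rect _ ab cd) (le_trans (box _))// contentE.
  by rewrite [xmin _]addeK// [xmax _]subeK// [ymin _]addeK// [ymax _]subeK//.
have mu_fin := le_lt_trans mu_le fin.
split; first exact: surrounds_finite_interior sur.
exact: le_trans (dgm_le_content muP mu_fin sur) (le_trans mu_le le).
Qed.
End Stability.

(** * Hall's condition along the family *)

Lemma labels_of {R : realType} (N : \bar R * \bar R -> nat)
    (A : set (\bar R * \bar R)) :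
  msum N A < +oo :> \bar R -> exists L : seq (\bar R * \bar R * nat),
    [/\ uniq L, forall b, b \in L <-> A b.1 /\ (b.2 < N b.1)%N &
      msum N A = (size L)%:R%:E :> \bar R].
Proof.
move=> /msum_support[s [us sP]].
exists [seq (z, k) | z <- s, k <- iota 0 (N z)]; split.
- apply: allpairs_uniq_dep => // [z _|[z k] [z' k'] _ _ [-> ->]//]; first exact: iota_uniq.
- move=> [z k]; split=> [/allpairsPdep[z' [k' [zs]]]|/= [Az kN]].
    rewrite mem_iota add0n /= => kN [-> ->]; split=> //.
    by case/sP: zs.
  apply/allpairsPdep; exists z, k; rewrite mem_iota add0n; split=> //.
  by apply/sP; split=> //; exact: leq_ltn_trans kN.
- rewrite (@msum_seq _ _ _ _ s)//; [|by move=> z /sP[]|by move=> z Az Nz; exact/sP].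
  rewrite size_allpairs_dep sumEFin -natr_sum sumnE big_map; congr (_%:R%:E).
  by apply: eq_bigr => z _; rewrite size_iota.
Qed.

Section Family.
Context {R : realType} (delta : R) (mu : R -> rect R -> \bar R).
Local Notation point := (\bar R * \bar R)%type.
Implicit Types (x y e : R) (z w : point).
Hypothesis delta_gt0 : (0 < delta)%R.
Hypothesis mu_rmeasure : forall x, (0 <= x <= delta)%R -> is_rmeasure (mu x).
Hypothesis box : forall x y (eta : {nonneg R}), (0 <= x <= delta)%R ->
  (0 <= y <= delta)%R -> (eta%:num = `|y - x|)%R ->
  forall r, mu x r <= mu y (thicken eta r).
Local Notation N x := (dgm (mu x)).
Local Notation F x := (finite_interior (mu x)).

Lemma dball_step x y z e : (0 <= x <= delta)%R -> (0 <= y <= delta)%R -> (0 <= e)%R ->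
  dball z (e + `|y - x|)%R `<=` F y ->
  dball z e `<=` F x /\
    msum (N x) (dball z e) <= msum (N y) (dball z (e + `|y - x|)%R) :> \bar R.
Proof.
move=> xI yI e0 zF.
have [eta etaE] : exists eta : {nonneg R}, (eta%:num = `|y - x|)%R.
  by exists (NngNum (normr_ge0 (y - x)%R)).
have widen p : p - e%:E - eta%:num%:E = p - (e + `|y - x|)%:E /\
    p + e%:E + eta%:num%:E = p + (e + `|y - x|)%:E.
  by rewrite etaE EFinD oppeD// !addeA.
have pe p : p - e%:E <= p + e%:E.
  by apply: leeD => //; rewrite -EFinN lee_fin; lra.
have [w11 w12] := widen z.1; have [w21 w22] := widen z.2.
have := cbox_box_inequality (mu_rmeasure xI) (mu_rmeasure yI)
  (box xI yI etaE) (pe z.1) (pe z.2).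
rewrite /= w11 w12 w21 w22; exact.
Qed.

Section Monotone.
Variable P : seq point.
Hypothesis P_deep : forall z, z \in P -> dball z delta `<=` F delta.

Definition nhood x : set point := [set w | exists2 z, z \in P & dball z x w].

Local Notation f x := (msum (N x) (nhood x) : \bar R).

Lemma nhood_center_sub x z : (0 <= x <= delta)%R -> z \in P -> dball z x `<=` F x.
Proof.
move=> xI zP; have [x0 xd] := andP xI.
have dE : (x + `|delta - x| = delta)%R by rewrite ger0_norm ?subr_ge0// addrC subrK.
have [||//] := @dball_step x delta z x xI _ x0; first by rewrite lexx ltW.
by rewrite dE; exact: P_deep.
Qed.

Lemma nhood_sub x : (0 <= x <= delta)%R -> nhood x `<=` F x.
Proof. by move=> xI w [z zP]; exact: nhood_center_sub. Qed.

Lemma nhood_dball x y z : nhood x z -> dball z (y - x)%R `<=` nhood y.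
Proof.
move=> [w wP wz] v zv; exists w => //.
by have := dball_trans wz zv; rewrite addrC subrK.
Qed.

Lemma nhood_fin x : (0 <= x <= delta)%R -> f x < +oo.
Proof.
move=> xI; have [x0 _] := andP xI.
apply: (@le_lt_trans _ _ (\sum_(z <- P) msum (N x) (dball z x))).
  by apply: msum_cover => w [z zP zw] _; exists z.
rewrite big_seq; apply: lte_sum_pinfty => z zP.
have pe p : p - x%:E <= p + x%:E.
  by apply: leeD => //; rewrite -EFinN lee_fin; lra.
apply: msum_cbox_fin; [exact: mu_rmeasure|exact: pe|exact: pe|exact: nhood_center_sub].
Qed.

(** While [y - x] is small, the balls of that radius around the points counted by [f x] are
    disjoint. Each retains at time [y] at least the multiplicity of its centre, and all of them lie
    in [nhood y]. *)
Lemma nhood_right x : (0 <= x < delta)%R -> exists2 e, (0 < e)%R &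
  forall y, (x < y)%R -> (y <= x + e)%R -> (y <= delta)%R -> f x <= f y.
Proof.
move=> /andP[x0 xd]; have xI : (0 <= x <= delta)%R by rewrite x0 ltW.
have [S [uS SP]] := msum_support (nhood_fin xI).
have [e e0 He] := dballs_separated S.
exists e => // y xy ye yd; have yI : (0 <= y <= delta)%R by lra.
rewrite (@msum_seq _ _ _ _ S)//; [|by move=> z /SP[]|by move=> z Uz Nz; exact/SP].
apply: (@le_trans _ _ (\sum_(z <- S) msum (N y) (dball z (y - x)%R))); last first.
  apply: msum_disjoint => // [z /SP[Uz _]|z w zS wS zw]; first exact: nhood_dball.
  by apply: He => //; lra.
rewrite big_seq [leRHS]big_seq; apply: lee_sum => z /SP[Uz _].
have dE : (0 + `|y - x| = y - x)%R by rewrite add0r gtr0_norm ?subr_gt0.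
have [|_] := @dball_step x y z 0 xI yI (lexx 0%R); rewrite dE.
  by move=> w /(nhood_dball Uz)/(nhood_sub yI).
by rewrite dball0 msum1.
Qed.

(** Every point counted at time [y] lies within [x - y] of one counted at time [x], so small balls
    around the latter cover; none of these balls holds more than the multiplicity of its centre. *)
Lemma nhood_left x : (0 < x <= delta)%R -> exists2 e, (0 < e)%R &
  forall y, (x - e <= y)%R -> (y < x)%R -> (0 <= y)%R -> f y <= f x.
Proof.
move=> /andP[x0 xd]; have xI : (0 <= x <= delta)%R by rewrite xd ltW.
have [S [uS SP]] := msum_support (nhood_fin xI).
have [|e e0 He] := @common_radius R _ S (fun b e' => dball b e' `<=` F x /\
    msum (N x) (dball b e') <= (N x b)%:R%:E :> \bar R).
  move=> b /SP[Ub _]; exact: dball_isolated (mu_rmeasure xI) (nhood_sub xI Ub).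
(* The balls of radius [x - y] are thickened once more by [x - y] in passing to time [x], and the
   result must stay within radius [e]. *)
exists (e / 2)%R; first by rewrite divr_gt0.
move=> y ye yx y0; have yI : (0 <= y <= delta)%R by lra.
have h0 : (0 <= x - y)%R by lra.
rewrite [leRHS](@msum_seq _ _ _ _ S)//; [|by move=> z /SP[]|by move=> z Uz Nz; exact/SP].
apply: (@le_trans _ _ (\sum_(b <- S) msum (N y) (dball b (x - y)%R))).
  apply: msum_cover => z Uz Nz.
  have zF : dball z (0 + `|x - y|)%R `<=` F x.
    by rewrite add0r ger0_norm// => w /(nhood_dball Uz)/(nhood_sub xI).
  have [_] := dball_step yI xI (lexx 0%R) zF.
  rewrite dball0 msum1 add0r ger0_norm// => le.
  (* The positive multiplicity of [z] at time [y] forces a diagram point at time [x] in the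
     thickened ball. *)
  have [b zb Nb] : exists2 b, dball z (x - y)%R b & (0 < N x b)%N.
    apply: contrapT => no; suff E : msum (N x) (dball z (x - y)%R) = 0 :> \bar R.
      by move: le; rewrite E lee_fin lern0; case: (N y z) Nz.
    apply: esum1 => b zb; case: (posnP (N x b)) => [->//|Nb].
    by case: no; exists b.
  exists b; last exact: dball_sym.
  by apply/SP; split=> //; exact: nhood_dball Uz _ zb.
rewrite big_seq [leRHS]big_seq; apply: lee_sum => b bS.
have [|bF le] := He ((x - y) + `|x - y|)%R b _ bS; first by rewrite ger0_norm//; lra.
by have [_ /le_trans] := dball_step yI xI h0 bF; apply.
Qed.

Lemma nhood_mono : f 0 <= f delta.
Proof.
(* Times are embedded in the extended line, where the induction runs; between [0] and [delta] they
   are finite, so [fine] loses nothing. *)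
have := @interval_induction R (fun s t => f (fine s) <= f (fine t)) 0%:E delta%:E.
apply; last by rewrite lte_fin.
- by move=> s p t _ _ _ _; exact: le_trans.
- move=> [r| |]//; rewrite lee_fin lte_fin => r0 rd.
  have [|e e0 He] := @nhood_right r; first by rewrite r0.
  exists (r + e)%:E; first by rewrite lte_fin; lra.
  by move=> [t| |]//; rewrite !lee_fin lte_fin => rt te td; exact: He.
- move=> [r| |]//; rewrite lee_fin lte_fin => r0 rd.
  have [|e e0 He] := @nhood_left r; first by rewrite r0.
  exists (r - e)%:E; first by rewrite lte_fin; lra.
  by move=> [t| |]//; rewrite !lee_fin lte_fin => rt te td; exact: He.
Qed.
End Monotone.

Lemma reverse_offset_dball (G : set point) z :
  reverse_offset G delta z -> dball z delta `<=` G.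
Proof.
move=> [_ ex] w /(dinfty_le _ _ (ltW delta_gt0)) zw.
apply: contrapT => Gw; move: ex; rewrite ltNge => /negP; apply.
by apply: le_trans zw; apply: ereal_inf_lbound; exists w.
Qed.

Lemma reverse_offset_sub : reverse_offset (F delta) delta `<=` F 0.
Proof.
move=> z /reverse_offset_dball zF.
have zP w : w \in [:: z] -> dball w delta `<=` F delta.
  by rewrite inE => /eqP ->.
apply: (nhood_center_sub zP (x := 0%R) (z := z)).
- by rewrite lexx ltW.
- by rewrite inE.
- exact: dball_center.
Qed.

Lemma one_sided_matching :
  exists M : set ((point * nat) * (point * nat)),
    [/\ M `<=` labelled (N 0) `*` labelled (N delta),
        forall a b b', M (a, b) -> M (a, b') -> b = b',
        forall a a' b, M (a, b) -> M (a', b) -> a = a',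
        forall a b, M (a, b) -> dinfty a.1 b.1 <= delta%:E &
        forall a, labelled (N 0) a -> reverse_offset (F delta) delta a.1 ->
          exists b, M (a, b)].
Proof.
have d0 := ltW delta_gt0.
have deltaI : (0 <= delta <= delta)%R by rewrite lexx d0.
have zeroI : (0 <= (0 : R) <= delta)%R by rewrite lexx d0.
pose A0 : set (point * nat) :=
  [set a | labelled (N 0) a /\ reverse_offset (F delta) delta a.1].
have deep (i : A0) : dball (val i).1 delta `<=` F delta.
  by apply: reverse_offset_dball; have [] := set_mem (valP i).
have /choice[L LP] : forall i : A0, exists L : seq (point * nat),
    forall b, b \in L <-> dball (val i).1 delta b.1 /\ labelled (N delta) b.
  move=> i; have zP w : w \in [:: (val i).1] -> dball w delta `<=` F delta.
    by rewrite inE => /eqP ->; exact: deep.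
  have [L [_ LP _]] := labels_of (nhood_fin zP deltaI).
  exists L => b; rewrite LP; split=> -[].
    by move=> [w]; rewrite inE => /eqP ->.
  by move=> ib Nb; split=> //; exists (val i).1; rewrite ?inE.
have [|g g_inj gL] :=
  @hall_marriage A0 (point * nat)%type (fun i => [fset b in L i]%fset).
  move=> J; pose P := [seq (val i).1 | i <- J].
  have zP w : w \in P -> dball w delta `<=` F delta.
    by move=> /mapP[i _ ->]; exact: deep.
  have [L0 [uL0 L0P L0E]] := labels_of (nhood_fin zP zeroI).
  have [L1 [uL1 L1P L1E]] := labels_of (nhood_fin zP deltaI).
  (* Each centre lies in its own ball of radius zero, so the distinct labelled points of [J] are
     among those counted by [f 0]. *)
  apply: (@leq_trans (size L0)).
    rewrite -(size_map val); apply: uniq_leq_size.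
      by rewrite map_inj_uniq; [exact: finmap.fset_uniq|exact: val_inj].
    move=> a /mapP[i iJ ->]; apply/L0P; split; last first.
      by have [] := set_mem (valP i).
    by exists (val i).1; [exact: map_f|exact: dball_center].
  apply: (@leq_trans (size L1)).
    by have := nhood_mono zP; rewrite L0E L1E lee_fin ler_nat.
  apply: uniq_leq_size => // b /L1P[[w /mapP[i iJ ->] ib] Nb].
  apply/bigfcupP; exists i; first by rewrite iJ.
  by rewrite !inE; apply/LP.
exists [set ab | exists2 i : A0, val i = ab.1 & g i = ab.2]; split.
- move=> [a b] [i /= <- <-]; split; first by have [] := set_mem (valP i).
  by have := gL i; rewrite inE /= => /LP[].
- by move=> a b b' [i /= <- <-] [j /= /val_inj -> <-].
- by move=> a a' b [i /= <- <-] [j /= <- /g_inj ->].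
- move=> a b [i /= <- <-]; have := gL i; rewrite inE /= => /LP[ib _].
  exact/dinfty_le.
- move=> a Na aF; have aA0 : a \in A0 by exact: mem_set.
  by exists (g (exist _ a aA0)), (exist _ a aA0).
Qed.
End Family.

Theorem theorem4p28 (R : realType) (delta : R) (mu : R -> rect R -> \bar R)
    (delta_gt0 : (0 < delta)%R)
    (mu_rmeasure : forall x : R, x \in `[0%R, delta] -> is_rmeasure (mu x))
    (box : forall x y : R, x \in `[0%R, delta] -> y \in `[0%R, delta] ->
      forall r : rect R, mu x r <= mu y (thicken (`|y - x|%:nng)%R r)) :
  exists M : set ((\bar R * \bar R * nat) * (\bar R * \bar R * nat)),
    is_matching delta
      (dgm (mu 0%R)) (finite_interior (mu 0%R))
      (dgm (mu delta)) (finite_interior (mu delta)) M.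
Proof.
have muP x : (0 <= x <= delta)%R -> is_rmeasure (mu x).
  by move=> xI; apply: mu_rmeasure; rewrite in_itv.
have boxP x y (eta : {nonneg R}) : (0 <= x <= delta)%R -> (0 <= y <= delta)%R ->
    (eta%:num = `|y - x|)%R -> forall r, mu x r <= mu y (thicken eta r).
  move=> xI yI etaE r; rewrite (_ : eta = (`|y - x|%:nng)%R); last exact: val_inj.
  by apply: box; rewrite in_itv.
(* The box inequality depends on the two times only through [|y - x|], so it survives time
   reversal. *)
pose nu x := mu (delta - x)%R.
have revI x : (0 <= x <= delta)%R -> (0 <= delta - x <= delta)%R by lra.
have nuP x : (0 <= x <= delta)%R -> is_rmeasure (nu x) by move=> /revI/muP.
have nu_box x y (eta : {nonneg R}) : (0 <= x <= delta)%R -> (0 <= y <= delta)%R ->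
    (eta%:num = `|y - x|)%R -> forall r, nu x r <= nu y (thicken eta r).
  move=> /revI xI /revI yI etaE; apply: boxP => //.
  by rewrite etaE distrC; congr (`|_|)%R; lra.
have [M1 [M1sub M1l M1r M1d M1tot]] := one_sided_matching delta_gt0 muP boxP.
have [M2 [M2sub M2l M2r M2d M2tot]] := one_sided_matching delta_gt0 nuP nu_box.
have := reverse_offset_sub delta_gt0 muP boxP.
have := reverse_offset_sub delta_gt0 nuP nu_box.
rewrite /nu subrr subr0 in M2sub M2tot * => offr offl.
set A := dgm (mu 0%R) in M1sub M1tot M2sub M2tot *.
set B := dgm (mu delta) in M1sub M1tot M2sub M2tot *.
have [||||||M [Msub Ml Mr MA MB]] := @combine_matchings _ _
  [set a | labelled A a /\ reverse_offset (finite_interior (mu delta)) delta a.1]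
  [set b | labelled B b /\ reverse_offset (finite_interior (mu 0%R)) delta b.1]
  M1 [set ab | M2 (ab.2, ab.1)].
- exact: M1l.
- exact: M1r.
- by move=> a b b'; exact: M2r.
- by move=> a a' b; exact: M2l.
- by move=> a [Aa aG]; exact: M1tot.
- by move=> b [Bb bF]; exact: M2tot.
exists M; split=> //.
- by move=> [a b] /Msub[/M1sub//|/M2sub[]].
- move=> a b /Msub[/M1d//|/M2d /=].
  move=> /(dinfty_le _ _ (ltW delta_gt0)) ba; apply/dinfty_le; first exact: ltW.
  by apply: dball_sym => //; exact: ltW.
- by move=> a Aa aG; exact: MA.
- by move=> b Bb bF; exact: MB.
Qed.
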